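(* (i) Let $r\in(0,1)$, let $m,m'\ge2$ be integers, and let $K\in\mathfrak{A}_m^r$, $K'\in\mathfrak{A}_{m'}^r$. Then the following are equivalent: $K$ and $K'$ are bilipschitz equivalent; $\dim_H K=\dim_H K'$; $m=m'$. (ii) Furthermore, let $r_1,r_2\in(0,1)$, let $m_1,m_2\ge2$ be integers, and let $K\in\mathfrak{A}_{m_1}^{r_1}$ and $K'\in\mathfrak{A}_{m_2}^{r_2}$. Then $K$ and $K'$ are bilipschitz equivalent if and only if there are integers $k_1,k_2\ge1$ such that $r_1^{k_1}=r_2^{k_2}$ and $m_1^{k_1}=m_2^{k_2}$.
   Context: Graph-directed sets: let $r\in(0,1)$, and let $G$ be a finite directed graph (multiple edges and loops allowed) with vertices $\{1,\dots,p\}$; let $\mathcal{E}_{i,j}$ be the set of edges from $i$ to $j$, and $A=(a_{i,j})_{1\le i,j\le p}$ with $a_{i,j}=\#\mathcal{E}_{i,j}$ the adjacency matrix. Every vertex has at least one outgoing edge. Let $(X,\mathrm{d})$ be a (nonempty) compact metric space and, for each edge $e$, let $S_e:X\to X$ satisfy $\mathrm{d}(S_ex,S_ey)=r\,\mathrm{d}(x,y)$ for all $x,y\in X$. There is a unique family $\{K_1,\dots,K_p\}$ of nonempty compact subsets of $X$ with $K_i=\bigcup_{j}\bigcup_{e\in\mathcal{E}_{i,j}}S_e(K_j)$ for every $i$; these are the graph-directed sets with ratio $r$. They are dust-like if for every $i$ this union is a disjoint union. They have integer characteristic $m$ (an integer $m\ge2$) if there is a vector $v\in\mathbb{R}^p$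 with all entries positive and $Av=mv$. $\mathfrak{A}_m^r$ is the class of all metric spaces $K$ such that $K=K_1$ for some dust-like graph-directed sets $\{K_i\}_i$ (in some compact metric space) with ratio $r$ and integer characteristic $m$. $\dim_H$ denotes Hausdorff dimension. Two metric spaces $(B,\mathrm{d}_B)$, $(B',\mathrm{d}_{B'})$ are bilipschitz equivalent if there are a bijection $f:B\to B'$ and a constant $C>0$ with $C^{-1}\mathrm{d}_B(x,y)\le \mathrm{d}_{B'}(f(x),f(y))\le C\,\mathrm{d}_B(x,y)$ for all $x,y\in B$. *)

(* Defs.v *)
From HB Require Import structures.
From mathcomp Require Import all_boot all_order all_algebra.
From mathcomp Require Import all_classical all_reals all_analysis.

Set Implicit Arguments.
Unset Strict Implicit.
Unset Printing Implicit Defensive.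

Import Order.TTheory GRing.Theory Num.Theory.

Local Open Scope ring_scope.

Record multidigraph (p : nat) := Multidigraph {
  edge : finType;
  src : edge -> 'I_p;
  tgt : edge -> 'I_p }.

Definition edges (p : nat) (G : multidigraph p) (i j : 'I_p) : {set edge G} :=
  [set e | (src e == i) && (tgt e == j)]%SET.

Definition adjacency (R : realType) (p : nat) (G : multidigraph p) : 'M[R]_p :=
  \matrix_(i, j) (#|edges G i j|)%:R.

Local Open Scope classical_set_scope.

Definition similarity (R : realType) (r : R) (X : metricType R) (f : X -> X) :=
  forall x y : X, mdist (f x) (f y) = r * mdist x y.

(* For a contraction ratio [0 < r < 1] on a nonempty compact [X] such a family
   [K] exists and is unique, so the predicate singles out *the* graph-directed
   sets of the system [(G, S)]. *)
Definition graph_directed_sets (R : realType) (r : R) (X : metricType R)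
    (p : nat) (G : multidigraph p) (S : edge G -> X -> X)
    (K : 'I_p -> set X) : Prop :=
  [/\ compact [set: X] /\ [set: X] !=set0,
      forall i, exists e : edge G, src e = i,
      forall e, similarity r (S e),
      forall i, K i !=set0 /\ compact (K i) &
      forall i, K i = \bigcup_(j in [set: 'I_p])
                        \bigcup_(e in [set` edges G i j]) (S e @` K j)].

Definition dust_like (R : realType) (X : metricType R)
    (p : nat) (G : multidigraph p) (S : edge G -> X -> X)
    (K : 'I_p -> set X) : Prop :=
  forall i, trivIset [set e | src e = i] (fun e => S e @` K (tgt e)).

Definition integer_characteristic (R : realType) (p : nat)
    (G : multidigraph p) (m : nat) : Prop :=
  exists2 v : 'cV[R]_p, (forall i, 0 < v i 0) &
    adjacency R G *m v = m%:R *: v.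

(* The class of metric spaces [T] that are the first set [K_1] (here [K ord0],
   the vertices being ['I_p.+1]) of dust-like graph-directed sets with ratio [r]
   and integer characteristic [m].  [T] is an abstract metric space while [K_1]
   is a subset of an ambient space [X], so "[T] is [K_1]" means that some
   distance-preserving map [iota] identifies [T] with the subspace [K_1]. *)
Definition frakA (R : realType) (r : R) (m : nat) (T : metricType R) : Prop :=
  exists (X : metricType R) (p : nat) (G : multidigraph p.+1)
    (S : edge G -> X -> X) (K : 'I_p.+1 -> set X) (iota : T -> X),
  [/\ graph_directed_sets r S K,
      dust_like S K,
      integer_characteristic R G m,
      forall x y, mdist (iota x) (iota y) = mdist x y &
      range iota = K ord0].

Definition bilipschitz_equivalent (R : realType) (T T' : metricType R) : Prop :=
  exists (f : T -> T') (C : R),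
  [/\ bijective f, 0 < C &
      forall x y, C^-1 * mdist x y <= mdist (f x) (f y) <= C * mdist x y].

Local Open Scope ereal_scope.

(* [0] is added to the set of distances so that the empty set has diameter 0. *)
Definition diam (R : realType) (T : metricType R) (A : set T) : \bar R :=
  ereal_sup (0 |` [set (mdist x.1 x.2)%:E | x in A `*` A]).

(* [diam A ^ s] with the usual conventions [0 ^ 0 = 1] for a point and
   [diam set0 ^ 0 = 0] (needed as countable covers are padded by [set0]). *)
Definition hausdorff_gauge (R : realType) (T : metricType R) (s : R)
    (A : set T) : \bar R :=
  if `[< A = set0 >] then 0 else diam A `^ s.

Definition hausdorff_premeasure (R : realType) (T : metricType R) (s delta : R)
    (A : set T) : \bar R :=
  ereal_inf [set \sum_(n <oo) hausdorff_gauge s (U n) | U in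
    [set U : nat -> set T |
      (forall n, diam (U n) <= delta%:E) /\ A `<=` \bigcup_n U n]].

Definition hausdorff_measure (R : realType) (T : metricType R) (s : R)
    (A : set T) : \bar R :=
  ereal_sup [set hausdorff_premeasure s delta A | delta in
    [set delta : R | (0 < delta)%R]].

Definition hausdorff_dim (R : realType) (T : metricType R) (A : set T)
    : \bar R :=
  ereal_inf [set s%:E | s in
    [set s : R | (0 <= s)%R /\ hausdorff_measure s A = 0]].

(* Main.v *)
(* The full shift on [m] symbols with the ultrametric [r ^ n] serves as a normal
   form: [K] in the class of [(r, m)] is bilipschitz equivalent to the shift of
   [(r ^ L, m ^ L)] for some [L].  A set is bilipschitz to a shift on [M] symbols
   as soon as it belongs to a family whose members split into exactly [M] members
   of the next level, all diameters and gaps being comparable to the scale.  An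
   integer eigenvector [v] gives each cylinder an integer mass.  After passing to
   a power of the graph, a vertex is either recurrent (its successors form a class
   in which all edges are present) or has recurrent successors.  In a recurrent
   class, dividing [v] by its gcd and using that every type of cylinder occurs
   many times, each [K i] is cut into [v i] pieces of mass exactly one unit, and
   these pieces split evenly into [M] similar pieces.  From a transient vertex
   fewer than [M] edges lead to transient vertices; the other cylinders are glued
   together and cut again into the missing number of pieces.

   Bilipschitz maps preserve the dimension, which is [ln m / - ln r] for the
   shift.  For the converse in (ii), read the same space in two codings and let
   [N w] be the number of cylinders of the second coding, of comparable size,
   contained in the cylinder [w] of the first.  The density
   [N w * m1 ^ |w| / m2 ^ level |w|] is bounded; next to a nearly maximal value it
   cannot vary, because [N] takes finitely many integer values.  Two descendants
   with the same [N] then give [m1 ^ k1 = m2 ^ k2]. *)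
Require Import Defs.
From mathcomp Require Import all_boot all_order all_algebra.
From mathcomp Require Import all_classical all_reals all_analysis.
From mathcomp Require Import ring lra zify.

Set Implicit Arguments.
Unset Strict Implicit.
Unset Printing Implicit Defensive.

Import Order.TTheory GRing.Theory Num.Theory.
Import numFieldNormedType.Exports.

Local Open Scope classical_set_scope.
Local Open Scope ring_scope.

(** * Separated partitions *)

Section Metric.
Variables (R : realType) (X : metricType R).
Implicit Types (A B P Q : set X) (c d : R) (N a b : nat).

Definition sep c A B := forall x y, A x -> B y -> c <= mdist x y.

Definition diam_le d A := forall x y, A x -> A y -> mdist x y <= d.

Lemma sepC c A B : sep c A B -> sep c B A.
Proof. by move=> s x y Bx Ay; rewrite metric_sym; exact: s. Qed.

Lemma sep_sub c c' A A' B B' : c' <= c -> A' `<=` A -> B' `<=` B ->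
  sep c A B -> sep c' A' B'.
Proof.
by move=> cc AA BB s x y /AA Ax /BB By; exact: le_trans (s _ _ Ax By).
Qed.

Lemma sepU c A B B' : sep c A B -> sep c A B' -> sep c A (B `|` B').
Proof. by move=> s s' x y Ax [By|By]; [exact: s|exact: s']. Qed.

Lemma diam_le_sub d d' A B : d <= d' -> A `<=` B -> diam_le d B -> diam_le d' A.
Proof.
by move=> dd AB D x y /AB Ax /AB Ay; exact: le_trans (D _ _ Ax Ay) dd.
Qed.

(** A binary tree of separated unions instead of an indexed family: cutting off, refining and
    mapping parts become inductions. Separation at every node makes the leaves pairwise
    [c]-separated. *)
Inductive parts (F : set X -> Prop) c : nat -> set X -> Prop :=
| parts0 : parts F c 0 set0
| parts1 A : F A -> parts F c 1 A
| partsU a b A B : parts F c a A -> parts F c b B -> sep c A B ->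
    parts F c (a + b) (A `|` B).

Lemma parts_eq0 F c A : parts F c 0 A -> A = set0.
Proof.
move En: 0%N => n p; elim: p En => // a b P Q pP IP pQ IQ s.
move/esym/eqP; rewrite addn_eq0 => /andP[/eqP a0 /eqP b0].
by rewrite IP// IQ// setU0.
Qed.

Lemma parts1_inv F c A : parts F c 1 A -> F A.
Proof.
move En: 1%N => n p; elim: p En => // a b P Q pP IP pQ IQ s.
case: a pP IP => [|[|a]] pP IP ab.
- by rewrite (parts_eq0 pP) set0U; apply: IQ.
- case: b pQ IQ ab => // pQ IQ _.
  by rewrite (parts_eq0 pQ) setU0; apply: IP.
- by [].
Qed.

(** The leaves are ordered from left to right; the cut after the first [a] of them falls in one of
    the two subtrees, and the other subtree is regrouped by associativity. *)
Lemma parts_split F c a b A : parts F c (a + b) A ->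
  exists A1 A2, [/\ parts F c a A1, parts F c b A2, sep c A1 A2 & A = A1 `|` A2].
Proof.
move En: (a + b)%N => n p; elim: p a b En => [|B FB|a' b' P Q pP IP pQ IQ s] a b.
- move=> /eqP; rewrite addn_eq0 => /andP[/eqP-> /eqP->].
  by exists set0, set0; split; rewrite ?setU0//; exact: parts0.
- case: a => [|a] ab.
    exists set0, B; split; rewrite ?set0U//; first exact: parts0.
    by rewrite -[b]add0n ab; exact: parts1.
  have [-> ->] : a = 0%N /\ b = 0%N by lia.
  exists B, set0; split; rewrite ?setU0//; first exact: parts1.
  exact: parts0.
- move=> ab; have [aa'|/ltnW a'a] := leqP a a'.
    have [P1 [P2 [p1 p2 s12 PE]]] := IP a (a' - a)%N (subnKC aa').
    exists P1, (P2 `|` Q); split => //.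
    + have -> : b = (a' - a + b')%N by lia.
      apply: partsU => //; apply: sep_sub s => //.
      by rewrite PE; exact: subsetUr.
    + apply: sepU => //; apply: sep_sub s => //.
      by rewrite PE; exact: subsetUl.
    + by rewrite PE setUA.
  have [Q1 [Q2 [q1 q2 s12 QE]]] := IQ (a - a')%N b ltac:(lia).
  exists (P `|` Q1), Q2; split => //.
  + have -> : a = (a' + (a - a'))%N by lia.
    apply: partsU => //; apply: sep_sub s => //.
    by rewrite QE; exact: subsetUl.
  + apply: sepC; apply: sepU; last exact: sepC.
    apply: sepC; apply: sep_sub s => //.
    by rewrite QE; exact: subsetUr.
  + by rewrite QE setUA.
Qed.

Lemma sub_parts F G c c' N A : (forall B, F B -> G B) -> c' <= c ->
  parts F c N A -> parts G c' N A.
Proof.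
move=> FG cc; elim=> [|B /FG FB|a b P Q pP IP pQ IQ s].
- exact: parts0.
- exact: parts1.
- by apply: partsU => //; exact: sep_sub s.
Qed.

Lemma parts_compact F c N A : (forall B, F B -> compact B) ->
  parts F c N A -> compact A.
Proof.
move=> FC; elim=> [|B /FC//|a b P Q pP IP pQ IQ s]; first exact: compact0.
exact: compactU.
Qed.

Lemma parts_bigcup F c (I : eqType) (s : seq I) (U : I -> set X) (n : I -> nat) :
  uniq s ->
  (forall i, i \in s -> parts F c (n i) (U i)) ->
  (forall i j, i \in s -> j \in s -> i != j -> sep c (U i) (U j)) ->
  parts F c (\sum_(i <- s) n i) (\bigcup_(i in [set` s]) U i).
Proof.
elim: s => [_ _ _|i s IH /= /andP[is_ us] pU sU].
  by rewrite big_nil set_nil bigcup_set0; exact: parts0.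
rewrite big_cons.
have -> : \bigcup_(j in [set` i :: s]) U j = U i `|` \bigcup_(j in [set` s]) U j.
  apply/seteqP; split=> [x [j /=]|x [Ux|[j /= js Ux]]].
  - by rewrite inE => /orP[/eqP->|js Ux]; [left|right; exists j].
  - by exists i => //=; rewrite mem_head.
  - by exists j => //=; rewrite inE js orbT.
apply: partsU.
- by apply: pU; rewrite mem_head.
- apply: IH => // [j js|j k js ks]; first by apply: pU; rewrite inE js orbT.
  by apply: sU; rewrite inE ?js ?ks orbT.
- move=> x y Ux [j /= js Uy]; apply: (sU i j) Ux Uy.
  + exact: mem_head.
  + by rewrite inE js orbT.
  + by apply: contraNneq is_ => ->.
Qed.

Lemma parts_bigcup_fin F c (I : finType) (J : {set I}) (U : I -> set X) (n : I -> nat) :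
  (forall i, i \in J -> parts F c (n i) (U i)) ->
  (forall i j, i \in J -> j \in J -> i != j -> sep c (U i) (U j)) ->
  parts F c (\sum_(i in J) n i) (\bigcup_(i in [set` J]) U i).
Proof.
move=> pU sU.
have -> : [set` J] = [set` enum J].
  by apply/seteqP; split=> i /=; rewrite mem_enum.
rewrite -big_enum/=; apply: parts_bigcup; first exact: enum_uniq.
  by move=> i; rewrite mem_enum; exact: pU.
by move=> i j; rewrite !mem_enum; exact: sU.
Qed.

Lemma parts_enum F c N A : parts F c N A -> exists f : nat -> set X,
  [/\ forall i, (i < N)%N -> F (f i),
      forall i j, (i < N)%N -> (j < N)%N -> i != j -> sep c (f i) (f j) &
      A = \bigcup_(i in [set i | (i < N)%N]) f i].
Proof.
elim=> [|B FB|a b P Q pP [f [Ff sf PE]] pQ [g [Fg sg QE]] s].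
- exists (fun=> set0); split => //.
  by apply/seteqP; split => // x [i].
- exists (fun=> B); split => //.
  + by move=> [|i] [|j].
  + by apply/seteqP; split => x; [move=> Bx; exists 0%N|case].
- exists (fun i => if (i < a)%N then f i else g (i - a)%N); split.
  + move=> i iab; case: ifPn => [/Ff//|ia]; apply: Fg; lia.
  + have fP i : (i < a)%N -> f i `<=` P by move=> ia x fx; rewrite PE; exists i.
    have gQ i : (i < b)%N -> g i `<=` Q by move=> ia x fx; rewrite QE; exists i.
    move=> i j iab jab ij; case: ifPn => ia; case: ifPn => ja.
    * exact: sf.
    * by apply: sep_sub s => //; [exact: fP|apply: gQ; lia].
    * by apply/sepC; apply: sep_sub s => //; [exact: fP|apply: gQ; lia].
    * by apply: sg; lia.
  + apply/seteqP; split => x.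
      rewrite PE QE => -[[i /= ia fx]|[i /= ib gx]].
        by exists i => /=; [lia|rewrite ia].
      exists (a + i)%N => /=; first by lia.
      by rewrite ifF ?addKn//; lia.
    move=> [i /= iab]; case: ifPn => ia hx.
      by left; rewrite PE; exists i.
    by right; rewrite QE; exists (i - a)%N => //=; lia.
Qed.

End Metric.

(** * Sets splitting evenly at every scale *)

Section Mary.
Variables (R : realType) (X : metricType R) (rho : R) (M : nat).
Hypotheses (rho01 : 0 < rho < 1) (M2 : (2 <= M)%N).
Implicit Types (A B P Q U V : set X) (C c d : R) (N n k : nat).

Let rho0 : 0 < rho. Proof. by case/andP: rho01. Qed.
Let rhoX n : 0 < rho ^+ n. Proof. exact: exprn_gt0. Qed.

Definition piece (F : nat -> set X -> Prop) C n P :=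
  [/\ compact P, P !=set0, diam_le (C * rho ^+ n) P &
      parts (F n.+1) (rho ^+ n / C) M P].

(* [P] is a piece of level [n] of some [M]-ary splitting with constant [C]: the
   greatest solution of [mary C n P -> piece (mary C) C n P]. *)
Definition mary C n P :=
  exists2 F : nat -> set X -> Prop, (forall n P, F n P -> piece F C n P) & F n P.

Lemma sub_piece (F G : nat -> set X -> Prop) C C' n P :
  (forall k Q, F k Q -> G k Q) -> 0 < C -> C <= C' ->
  piece F C n P -> piece G C' n P.
Proof.
move=> FG C0 CC [cP P0 dP pP]; split => //.
  by apply: diam_le_sub dP => //; rewrite ler_pM2r.
apply: sub_parts pP; first exact: FG.
by rewrite ler_pM2l// lef_pV2// posrE// (lt_le_trans C0).
Qed.

Lemma mary_piece C n P : 0 < C -> mary C n P -> piece (mary C) C n P.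
Proof.
move=> C0 [F FP /FP]; apply: sub_piece => // k Q FQ.
by exists F.
Qed.

(** Coinduction up to known pieces: a child may lie in the invariant or already be [mary], because
    the union of both families satisfies the clause. *)
Lemma mary_coind (F : nat -> set X -> Prop) C : 0 < C ->
  (forall n P, F n P -> piece (fun k Q => F k Q \/ mary C k Q) C n P) ->
  forall n P, F n P -> mary C n P.
Proof.
move=> C0 Fp n P FP; exists (fun k Q => F k Q \/ mary C k Q); last by left.
move=> k Q [/Fp//|/(mary_piece C0)]; apply: sub_piece => // ? ?; by right.
Qed.

Lemma mary_le C C' n P : 0 < C -> C <= C' -> mary C n P -> mary C' n P.
Proof.
move=> C0 CC mP; have C'0 := lt_le_trans C0 CC.
apply: mary_coind mP => // {}n {}P /(mary_piece C0).
by apply: sub_piece => // k Q; left.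
Qed.

(** Relabelling shrinks the nominal scale by [rho ^+ k]; the larger constant restores the diameter
    bound and only weakens the gap bound. *)
Lemma mary_up C n k P : 0 < C -> mary C n P -> mary (C / rho ^+ k) (n + k) P.
Proof.
move=> C0 [F FP Fn]; exists (fun m Q => exists2 n', m = (n' + k)%N & F n' Q);
  last by exists n.
move=> m Q [n' -> FQ]; have [cQ Q0 dQ pQ] := FP _ _ FQ; split => //.
  apply: diam_le_sub dQ => //.
  by rewrite exprD mulrCA divfK ?(mulrC _ C)// lt0r_neq0.
apply: sub_parts pQ => [B FB|]; first by exists n'.+1.
rewrite invf_div mulrA ler_wpM2r ?invr_ge0 ?(ltW C0)//.
rewrite -exprD ler_wiXn2l ?(ltW rho0)//; first by case/andP: rho01 => _ /ltW.
by lia.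
Qed.

Lemma mary_down C n k P : 0 < C -> mary C (n + k) P -> mary (C / rho ^+ k) n P.
Proof.
move=> C0 [F FP Fn]; exists (fun m => F (m + k)%N) => // m Q /FP [cQ Q0 dQ pQ].
split => //.
  apply: diam_le_sub dQ => //.
  rewrite mulrAC ler_pdivlMr// -mulrA -exprD ler_pM2l//.
  rewrite ler_wiXn2l ?(ltW rho0)//; first by case/andP: rho01 => _ /ltW.
  by lia.
apply: sub_parts pQ => //.
by rewrite invf_div mulrA -exprD.
Qed.

(* Split [U] into [U1], [U2] and [M - 2] other parts.  Then [U `|` V] splits into
   [U1 `|` U2], those [M - 2] parts and [V], read one level higher; only the part
   [U1 `|` U2] is again a union of two pieces, so the constant never degrades. *)
Lemma mary_glue2 C n U V : 0 < C -> mary C n U -> mary C n V ->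
  sep (rho ^+ n / C) U V -> diam_le (C * rho ^+ n) (U `|` V) ->
  mary (C / rho) n (U `|` V).
Proof.
move=> C0 mU mV sUV dUV; have Cr0 : 0 < C / rho by rewrite divr_gt0.
have CCr : C <= C / rho by rewrite ler_pdivlMr// ler_piMr ?(ltW C0)//; case/andP: rho01 => _ /ltW.
(* The union of [U1] and [U2] lies in [U], so its diameter is at most
   [C * rho ^+ k = C / rho * rho ^+ k.+1]: the relaxed bound is met again at level [k.+1], with
   pieces still of constant [C]. *)
pose F k A := exists U V, [/\ mary C k U, mary C k V, sep (rho ^+ k / C) U V,
  diam_le (C / rho * rho ^+ k) (U `|` V) & A = U `|` V].
have : F n (U `|` V).
  by exists U, V; split => //; apply: diam_le_sub dUV => //; rewrite ler_pM2r.
apply: mary_coind => // {U V mU mV sUV dUV}k _ [U [V [mU mV sUV dUV ->]]].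
have cC : rho ^+ k / (C / rho) <= rho ^+ k / C.
  by rewrite ler_pM2l// lef_pV2.
have [cU U0 dU pU] := mary_piece C0 mU; have [cV V0 _ _] := mary_piece C0 mV.
split => //; [exact: compactU|by case: U0 => x Ux; exists x; left|].
move: pU; have -> : M = (1 + (1 + (M - 2)))%N by lia.
move=> /parts_split [U1 [W [/parts1_inv mU1 /parts_split]]].
move=> [U2 [U3 [/parts1_inv mU2 p3 s23 -> s1W UE]]].
have -> : U `|` V = (U1 `|` U2) `|` (U3 `|` V) by rewrite UE !setUA.
have -> : (1 + (1 + (M - 2)))%N = (1 + ((M - 2) + 1))%N by lia.
have s13 : sep (rho ^+ k / C) U1 U3 by apply: sep_sub s1W => //; exact: subsetUr.
have s12 : sep (rho ^+ k / C) U1 U2 by apply: sep_sub s1W => //; exact: subsetUl.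
have U123 : [/\ U1 `<=` U, U2 `<=` U & U3 `<=` U].
  by rewrite UE; split => x; [left|right;left|right;right].
have [U1U U2U U3U] := U123.
apply: partsU; [apply: parts1; left|apply: partsU|].
- exists U1, U2; split => //.
    apply: sep_sub s12 => //; rewrite ler_pM2r ?invr_gt0// exprS.
    by rewrite ler_piMl ?(ltW (rhoX k))//; case/andP: rho01 => _ /ltW.
  apply: diam_le_sub dU; last by rewrite UE setUA; exact: subsetUl.
  by rewrite exprS mulrA divfK// lt0r_neq0.
- by apply: sub_parts p3 => // B mB; right; exact: mary_le mB.
- apply: parts1; right; rewrite -addn1.
  by have := mary_up 1 C0 mV; rewrite expr1.
- by apply: sep_sub sUV.
- apply: sepU.
    apply: sepC; apply: sepU; apply: sepC.
      by apply: sep_sub s13.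
    by apply: sep_sub s23.
  apply: sep_sub sUV => //.
  by rewrite subUset.
Qed.

(** Parts are added one at a time, each costing a factor [rho^-1], so the constant depends on the
    number of parts but not on the level. *)
Lemma mary_glue N C : (0 < N)%N -> 0 < C -> exists2 C', 0 < C' &
  forall n P, parts (mary C n) (rho ^+ n / C) N P -> diam_le (C * rho ^+ n) P ->
  mary C' n P.
Proof.
move=> + C0; case: N => // N _; exists (C / rho ^+ N); first by rewrite divr_gt0.
have Ck k : C <= C / rho ^+ k.
  by rewrite ler_pdivlMr// ler_piMr ?(ltW C0)// exprn_ile1 ?(ltW rho0)//; case/andP: rho01 => _ /ltW.
elim: N => [|N IH] n P.
  by move=> /parts1_inv + _; rewrite expr0 divr1.
rewrite -[N.+2]add1n => /parts_split[U [V [/parts1_inv mU pV sUV PE]]] dP.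
have mV : mary (C / rho ^+ N) n V.
  by apply: IH => //; apply: diam_le_sub dP => //; rewrite PE; exact: subsetUr.
have CN0 : 0 < C / rho ^+ N by rewrite divr_gt0.
rewrite PE exprSr invfM mulrA; apply: mary_glue2 => //.
- exact: mary_le mU.
- by apply: sep_sub sUV => //; rewrite ler_pM2l// lef_pV2.
- by rewrite -PE; apply: diam_le_sub dP => //; rewrite ler_pM2r.
Qed.

(** Refinement alone changes the number of parts by multiples of [M - 1]. To reach any [N], keep one
    child, glue the other [M.-1] into one piece, read both at level [n] again and cut that piece
    further. *)
Lemma mary_partition N C : (0 < N)%N -> 0 < C -> exists2 C', 0 < C' &
  forall n P, mary C n P -> parts (mary C' n) (rho ^+ n / C') N P.
Proof.
move=> + C0; case: N => // N _; elim: N C C0 => [|N IH] C C0.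
  by exists C => // n P; exact: parts1.
have M1 : (0 < M.-1)%N by lia.
have Cr0 : 0 < C / rho by rewrite divr_gt0.
have CCr : C <= C / rho by rewrite ler_pdivlMr// ler_piMr ?(ltW C0)//; case/andP: rho01 => _ /ltW.
have [C1 C10 glue] := mary_glue M1 Cr0.
have C1r0 : 0 < C1 / rho by rewrite divr_gt0.
have [C2 C20 part] := IH _ C1r0.
exists (C / rho + C2); first by rewrite addr_gt0.
have rle : rho <= 1 by case/andP: rho01 => _ /ltW.
move=> n P /(mary_piece C0) [cP P0 dP].
have -> : M = (1 + M.-1)%N by lia.
move=> /parts_split[U [V [/parts1_inv mU pV sUV PE]]].
have {}mU : mary (C / rho) n U.
  by have := @mary_down C n 1 U C0; rewrite expr1 addn1; apply.
have {}mV : mary (C1 / rho) n V.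
  have := @mary_down C1 n 1 V C10; rewrite expr1 addn1; apply.
  apply: glue.
    apply: sub_parts pV => [B|].
      exact: mary_le.
    rewrite exprS invf_div.
    have -> : rho * rho ^+ n * (rho / C) = rho ^+ n / C * (rho * rho) by ring.
    by rewrite ler_piMr ?divr_ge0 ?(ltW C0) ?(ltW (rhoX n))// mulr_ile1 ?(ltW rho0).
  by apply: diam_le_sub dP; [rewrite exprS mulrA divfK// lt0r_neq0|rewrite PE; exact: subsetUr].
rewrite PE -[N.+2]add1n; apply: partsU.
- apply: parts1; apply: mary_le mU => //.
  by rewrite lerDl ltW.
- apply: sub_parts (part _ _ mV) => [B|].
    by apply: mary_le => //; rewrite lerDr ltW.
  by rewrite ler_pM2l// lef_pV2 ?posrE ?addr_gt0// lerDr ltW.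
- apply: sep_sub sUV => //; rewrite ler_pM2l// lef_pV2 ?posrE ?addr_gt0//.
  by rewrite (le_trans CCr)// lerDl ltW.
Qed.

End Mary.

(** * Similarities and images of splittings *)

Section Similarity.
Variables (R : realType) (X : metricType R).
Implicit Types (A B P Q : set X) (c s : R).

Lemma similarity_continuous s (f : X -> X) : 0 < s -> similarity s f -> continuous f.
Proof.
move=> s0 fs x; apply/metricType_numDomainType.cvgrPdist_lt => e e0.
apply/metricType_numDomainType.nbhs_mdistP; exists (e / s); first by rewrite /= divr_gt0.
by move=> y /=; rewrite fs ltr_pdivlMr// mulrC.
Qed.

Lemma similarity_compact s (f : X -> X) A : 0 < s -> similarity s f ->
  compact A -> compact (f @` A).
Proof.
move=> s0 fs; apply: continuous_compact; apply: continuous_subspaceT.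
exact: similarity_continuous fs.
Qed.

Lemma sep_image s c (f : X -> X) A B : 0 <= s -> similarity s f ->
  sep c A B -> sep (s * c) (f @` A) (f @` B).
Proof.
by move=> s0 fs sAB _ _ [x Ax <-] [y By <-]; rewrite fs ler_wpM2l// sAB.
Qed.

Lemma diam_le_image s c (f : X -> X) A : 0 <= s -> similarity s f ->
  diam_le c A -> diam_le (s * c) (f @` A).
Proof.
by move=> s0 fs dA _ _ [x Ax <-] [y By <-]; rewrite fs ler_wpM2l// dA.
Qed.

Lemma parts_image (F G : set X -> Prop) s c (f : X -> X) N A :
  0 <= s -> similarity s f -> (forall B, F B -> G (f @` B)) ->
  parts F c N A -> parts G (s * c) N (f @` A).
Proof.
move=> s0 fs FG; elim=> [|B FB|a b P Q pP IP pQ IQ sPQ].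
- by rewrite image_set0; exact: parts0.
- by apply: parts1; exact: FG.
- by rewrite image_setU; apply: partsU => //; exact: sep_image.
Qed.

Lemma similarity_comp s t (f g : X -> X) : similarity s f -> similarity t g ->
  similarity (s * t) (f \o g).
Proof. by move=> fs gt x y; rewrite /= fs gt mulrA. Qed.

End Similarity.

Section MaryImage.
Variables (R : realType) (X : metricType R) (rho : R) (M : nat).
Hypotheses (rho01 : 0 < rho < 1) (M2 : (2 <= M)%N).
Local Notation mary := (@mary R X rho M).

Let rho0 : 0 < rho. Proof. by case/andP: rho01. Qed.
Let rhoX n : 0 < rho ^+ n. Proof. exact: exprn_gt0. Qed.

Lemma mary_image C n k (f : X -> X) P : similarity (rho ^+ k) f ->
  mary C n P -> mary C (k + n) (f @` P).
Proof.
move=> fs [F FP Fn].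
exists (fun m Q => exists n' Q', [/\ m = (k + n')%N, F n' Q' & Q = f @` Q']);
  last by exists n, P.
move=> m Q [n' [Q' [-> FQ' ->]]].
have [cQ Q0 dQ pQ] := FP _ _ FQ'; split.
- exact: similarity_compact (rhoX _) fs cQ.
- by case: Q0 => x Qx; exists (f x), x.
- apply: diam_le_sub (diam_le_image (ltW (rhoX k)) fs dQ) => //.
  by rewrite exprD mulrCA.
- rewrite exprD -mulrA; apply: parts_image (ltW (rhoX k)) fs _ pQ => B FB.
  by exists n'.+1, B; rewrite addnS.
Qed.

(** One splitting at unit scale suffices: similarities of ratio [rho ^+ n] carry it to level [n],
    scaling diameters and gaps alike, so one constant serves all levels. *)
Lemma mary_of_similar_pieces (S : set (set X)) C c D : 0 < C -> 0 < c ->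
  diam_le D [set: X] ->
  (forall Q, S Q -> [/\ compact Q, Q !=set0 &
     parts (fun B => (exists (g : X -> X) Q', [/\ similarity rho g, S Q' & B = g @` Q']) \/
                     mary C 1 B) c M Q]) ->
  exists2 C', 0 < C' & forall Q, S Q -> mary C' 0 Q.
Proof.
move=> C0 c0 DX SQ; pose C' := C + `|D| + c^-1.
have C'0 : 0 < C' by rewrite !ltr_wpDr ?invr_ge0 ?(ltW c0).
have CC' : C <= C' by rewrite /C' -addrA lerDl addr_ge0// invr_ge0 ltW.
exists C' => // Q0 SQ0.
pose F n P := exists (f : X -> X) Q, [/\ similarity (rho ^+ n) f, S Q & P = f @` Q].
have : F 0%N Q0.
  exists id, Q0; split => //; first by move=> x y; rewrite expr0 mul1r.
  by rewrite image_id.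
apply: mary_coind => // n _ [f [Q [fs SQ' ->]]].
have [cQ [x Qx] pQ] := SQ _ SQ'; split.
- exact: similarity_compact (rhoX _) fs cQ.
- by exists (f x), x.
- move=> _ _ [y _ <-] [z _ <-]; rewrite fs mulrC ler_pM2r//.
  rewrite (le_trans (DX y z _ _))// (le_trans (ler_norm D))//.
  by rewrite /C' addrAC lerDr addr_ge0 ?invr_ge0 ?(ltW C0) ?(ltW c0).
- apply: sub_parts (parts_image (ltW (rhoX n)) fs _ pQ) => [B HB| |B HB].
  + exact: HB.
  + rewrite ler_pM2l// -[leRHS]invrK lef_pV2 ?posrE ?invr_gt0//.
    by rewrite /C' lerDr addr_ge0 ?(ltW C0).
  + case: HB => [[g [Q' [gs SQ'' ->]]]|mB].
      left; exists (f \o g), Q'; split => //; last by rewrite image_comp.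
      by rewrite exprSr; exact: similarity_comp.
    right; rewrite -addn1; apply: mary_image fs _; exact: mary_le mB.
Qed.

End MaryImage.

(** * Codings by the full shift *)

Section NestedCompact.
Variables (R : realType) (X : metricType R).

Lemma nested_compact (P : nat -> set X) : (forall n, compact (P n)) ->
  (forall n, P n !=set0) -> (forall n, P n.+1 `<=` P n) ->
  exists x, forall n, P n x.
Proof.
move=> cP P0 dP.
have dPle n k : P (n + k)%N `<=` P n.
  elim: k => [|k IH]; first by rewrite addn0.
  by rewrite addnS; apply: subset_trans (dP _) IH.
have FF : ProperFilter (filter_from [set: nat] P).
  apply: filter_from_proper; last by move=> n _; exact: P0.
  apply: filter_from_filter; first by exists 0%N.
  move=> i j _ _; exists (i + j)%N => //= x Px; split; first exact: dPle Px.
  by apply: (@dPle j i); rewrite addnC.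
have [x [_ clx]] : P 0%N `&` cluster (filter_from [set: nat] P) !=set0.
  by apply: cP; exists 0%N.
exists x => n.
have /closure_id -> : closed (P n) by apply: compact_closed => //; exact: metric_hausdorff.
by move=> B nB; apply: clx nB; exists n.
Qed.

End NestedCompact.

(* [T] is the full shift on [M] symbols, up to a bilipschitz change of the
   ultrametric [rho ^+ n], [n] being the first place where two words differ. *)
Definition coded (R : realType) (rho : R) (M : nat) (T : metricType R) :=
  exists (h : T -> nat -> 'I_M) (C : R),
  [/\ 0 < C,
      forall u : nat -> 'I_M, exists x, forall n, h x n = u n,
      forall x y n, (forall k, (k < n)%N -> h x k = h y k) -> mdist x y <= C * rho ^+ n &
      forall x y n, h x n <> h y n -> rho ^+ n <= C * mdist x y].

(** The letters of a point record which child contains it at each level. Every word occurs because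
    the pieces along it are nested compact sets; diameters give the upper estimate and gaps the
    lower one. *)
Lemma mary_coded (R : realType) (X T : metricType R) (rho : R) (M : nat)
    (iota : T -> X) C : 0 < rho < 1 -> (2 <= M)%N -> 0 < C ->
  (forall x y, mdist (iota x) (iota y) = mdist x y) ->
  mary rho M C 0 (range iota) -> coded rho M T.
Proof.
move=> rho01 M2 C0 isoi m0; have rho0 : 0 < rho by case/andP: rho01.
have M0 : (0 < M)%N by exact: ltn_trans M2.
have /choice[F FP] : forall nP : nat * set X, exists F : nat -> set X,
    mary rho M C nP.1 nP.2 -> [/\ forall i, (i < M)%N -> mary rho M C nP.1.+1 (F i),
      forall i j, (i < M)%N -> (j < M)%N -> i != j -> sep (rho ^+ nP.1 / C) (F i) (F j) &
      nP.2 = \bigcup_(i in [set i | (i < M)%N]) F i].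
  move=> -[n P] /=.
  have [mP|nmP] := pselect (mary rho M C n P); last by exists (fun=> set0).
  by have [_ _ _ /parts_enum[f fP]] := mary_piece rho01 C0 mP; exists f.
have /choice[g gP] : forall z : nat * set X * X, exists i : 'I_M,
    mary rho M C z.1.1 z.1.2 -> z.1.2 z.2 -> F z.1 i z.2.
  move=> -[[n P] x] /=.
  have [[mP Px]|nmP] := pselect (mary rho M C n P /\ P x); last first.
    by exists (Ordinal M0) => mP Px; exfalso; apply: nmP.
  have [_ _ /= PE] := FP (n, P) mP.
  move: (Px); rewrite {1}PE => -[i /= iM Fx].
  by exists (Ordinal iM).
(* [pc u n] is the piece reached by the first [n] letters of [u]; below, [Q] follows a point instead
   and [h] reads off its letters. *)
pose pc (u : nat -> 'I_M) := fix pc n := if n is k.+1 then F (k, pc k) (u k) else range iota.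
have mpc u n : mary rho M C n (pc u n).
  elim: n => [//|n IH] /=; have [mF _ _] := FP (n, pc u n) IH.
  exact: mF.
have pcS u n : pc u n.+1 `<=` pc u n.
  move=> x /= Fx; have [_ _ /= ->] := FP (n, pc u n) (mpc u n).
  by exists (u n) => /=.
pose Q x := fix Q n := if n is k.+1 then F (k, Q k) (g (k, Q k, x)) else range iota.
pose h x n := g (n, Q (iota x) n, iota x).
have QE x n : Q (iota x) n = pc (h x) n.
  by elim: n => [//|n IH] /=; rewrite /h IH.
have Qx x n : Q (iota x) n (iota x).
  elim: n => [/=|n IH]; first by exists x.
  have mQ : mary rho M C n (Q (iota x) n) by rewrite QE.
  exact: (gP (n, Q (iota x) n, iota x) mQ IH).
have pc_eq u v n : (forall k, (k < n)%N -> u k = v k) -> pc u n = pc v n.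
  elim: n => [//|n IH] uv /=; rewrite IH ?uv// => k kn; apply: uv.
  exact: ltnW.
have sepF x y n : (forall k, (k < n)%N -> h x k = h y k) -> h x n <> h y n ->
    rho ^+ n <= C * mdist x y.
  move=> xy nxy; rewrite -ler_pdivrMl// mulrC -isoi.
  have [_ sF _] := FP (n, pc (h x) n) (mpc _ _).
  apply: (sF (h x n) (h y n)) => //; first by apply/eqP => /ord_inj.
    by have := Qx x n.+1; rewrite QE.
  by have := Qx y n.+1; rewrite QE /= (pc_eq (h x) (h y)).
exists h, C; split => //.
- move=> u; have [z zP] : exists z, forall n, pc u n z.
    apply: nested_compact => [n|n|n]; [| |exact: pcS].
      by have [] := mary_piece rho01 C0 (mpc u n).
    by have [] := mary_piece rho01 C0 (mpc u n).
  have [x _ xz] := zP 0%N; exists x => n.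
  (* At a first place where [h x] and [u] differ, [z] would lie in two separated children, at
     positive distance from itself. *)
  have [n' le_n'] := ubnP n; elim: n' n le_n' => // n' IH n; rewrite ltnS => nn'.
  have eqn k : (k < n)%N -> h x k = u k by move=> kn; apply: IH; exact: leq_trans nn'.
  apply: contrapT => hu.
  have [_ sF _] := FP (n, pc u n) (mpc _ _).
  have : rho ^+ n / C <= mdist z z.
    apply: (sF (h x n) (u n)) => //; first by apply/eqP => /ord_inj.
      by have := Qx x n.+1; rewrite QE /= (pc_eq _ u)// xz.
    exact: (zP n.+1).
  by rewrite mdistxx leNgt divr_gt0// exprn_gt0.
- move=> x y n xy; rewrite -isoi.
  have [_ _ dP _] := mary_piece rho01 C0 (mpc (h x) n).
  apply: dP; first by rewrite -QE.
  by rewrite (pc_eq _ _ _ xy) -QE.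
- move=> x y n nxy.
  pose p k := h x k != h y k.
  have ex : exists k, p k by exists n; apply/eqP.
  have := ex_minnP ex; case=> k pk kmin.
  have kn : (k <= n)%N by apply: kmin; apply/eqP.
  apply: (@le_trans _ _ (rho ^+ k)).
    by rewrite ler_wiXn2l// ltW//; case/andP: rho01.
  apply: sepF; last exact/eqP.
  move=> j jk; apply/eqP; apply: contraTT jk => pj.
  by rewrite -leqNgt; exact: kmin.
Qed.

(** Blocks of [L] letters become single letters. A differing block locates the difference only up to
    [L] places, hence the factor [rho ^+ L] in the constant. *)
Lemma coded_pow (R : realType) (T : metricType R) (rho : R) (M L : nat) :
  0 < rho < 1 -> (0 < L)%N -> coded rho M T -> coded (rho ^+ L) (M ^ L) T.
Proof.
move=> rho01 L0 [h [C [C0 hs ha hd]]].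
have cardE : #|{ffun 'I_L -> 'I_M}| = (M ^ L)%N by rewrite card_ffun !card_ord.
pose b (x : T) q : {ffun 'I_L -> 'I_M} := [ffun s : 'I_L => h x (q * L + s)%N].
exists (fun x q => cast_ord cardE (enum_rank (b x q))).
have rho0 : 0 < rho by case/andP: rho01.
exists (C / rho ^+ L); split; first by rewrite divr_gt0// exprn_gt0.
- move=> u.
  pose v n : 'I_M := (enum_val (cast_ord (esym cardE) (u (n %/ L)%N)) : {ffun 'I_L -> 'I_M})
                        (Ordinal (ltn_pmod n L0)).
  have [x xv] := hs v; exists x => q.
  rewrite -[RHS](cast_ordKV cardE); congr cast_ord.
  rewrite -[RHS]enum_valK; congr enum_rank.
  apply/ffunP => s; rewrite ffunE xv /v.
  rewrite divnMDl// divn_small// addn0; congr (fun_of_fin _ _).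
  by apply: val_inj; rewrite /= modnMDl modn_small.
- move=> x y n xy; rewrite -exprM mulnC.
  rewrite (le_trans (ha x y (n * L)%N _))//.
    move=> k kn; have kL : (k %/ L < n)%N by rewrite ltn_divLR.
    have /cast_ord_inj/enum_rank_inj/ffunP/(_ (Ordinal (ltn_pmod k L0))) := xy _ kL.
    by rewrite !ffunE /= -divn_eq.
  rewrite ler_wpM2r ?exprn_ge0 ?(ltW rho0)//.
  rewrite ler_pdivlMr ?exprn_gt0// ler_piMr ?(ltW C0)//.
  by rewrite exprn_ile1 ?ltW//; case/andP: rho01.
- move=> x y n nxy.
  have [s sP] : exists s : 'I_L, h x (n * L + s)%N <> h y (n * L + s)%N.
    apply: contrapT => hxy; apply: nxy; congr cast_ord; congr enum_rank.
    apply/ffunP => s; rewrite !ffunE; apply: contrapT => hs'.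
    by apply: hxy; exists s.
  have := hd _ _ _ sP; rewrite mulrAC ler_pdivlMr ?exprn_gt0//.
  apply: le_trans; rewrite -exprM -exprD ler_wiXn2l ?(ltW rho0)//.
    by case/andP: rho01 => _ /ltW.
  by rewrite (mulnC n) leq_add2l ltnW.
Qed.

Lemma exprn_lt_eps (R : realType) (r e : R) : 0 < r < 1 -> 0 < e ->
  exists n, r ^+ n < e.
Proof.
move=> /andP[r0 r1] e0.
have : (fun n => r ^+ n) @ \oo --> (0 : R) by apply: cvg_expr; rewrite ger0_norm ?ltW.
move/cvgrPdist_lt => /(_ e e0) [N _ /(_ N (leqnn N))] /=.
by rewrite sub0r normrN ger0_norm ?exprn_ge0 ?(ltW r0)// => ?; exists N.
Qed.

Lemma coded_inj (R : realType) (T : metricType R) (rho : R) M (h : T -> nat -> 'I_M) C :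
  0 < rho < 1 -> 0 < C ->
  (forall x y n, (forall k, (k < n)%N -> h x k = h y k) -> mdist x y <= C * rho ^+ n) ->
  forall x y, (forall n, h x n = h y n) -> x = y.
Proof.
move=> rho01 C0 ha x y xy; apply/eqP; rewrite -[_ == _]negbK -mdist_gt0.
apply/negP => d0; have [n] := exprn_lt_eps rho01 (divr_gt0 d0 C0).
by rewrite ltr_pdivlMr// mulrC ltNge ha.
Qed.

Lemma first_difference (A : eqType) (u v : nat -> A) :
  (forall n, u n = v n) \/
  exists2 n, (forall k, (k < n)%N -> u k = v k) & u n <> v n.
Proof.
have [uv|] := pselect (forall n, u n = v n); [by left|].
move=> /existsNP[n nuv]; right.
have ex : exists k, u k != v k by exists n; apply/eqP.
case: (ex_minnP ex) => k /eqP pk kmin; exists k => // j jk.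
by apply/eqP; apply: contraTT jk => /kmin; rewrite -leqNgt.
Qed.

(** Points with the same word are matched; in both spaces the distance is comparable to [rho ^+ n]
    at the first differing place [n]. *)
Lemma coded_bilipschitz (R : realType) (T T' : metricType R) (rho : R) M :
  0 < rho < 1 -> coded rho M T -> coded rho M T' -> bilipschitz_equivalent T T'.
Proof.
move=> rho01 [h [C [C0 hs ha hd]]] [h' [C' [C'0 hs' ha' hd']]].
have [f fP] := choice (fun x => hs' (h x)).
have [g gP] := choice (fun y => hs (h' y)).
exists f, (C * C'); split; last first.
- move=> x y; case: (first_difference (h x) (h y)) => [xy|[n xy nxy]].
    by rewrite (coded_inj rho01 C0 ha xy) !mdistxx !mulr0 lexx.
  apply/andP; split.
    rewrite ler_pdivrMl ?mulr_gt0// (le_trans (ha _ _ _ xy))//.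
    rewrite -mulrA ler_pM2l//; apply: hd'; rewrite !fP; exact: nxy.
  apply: (@le_trans _ _ (C' * rho ^+ n)).
    by apply: ha' => k kn; rewrite !fP xy.
  by rewrite [C * C']mulrC -mulrA ler_pM2l//; exact: hd.
- exact: mulr_gt0.
- exists g => x.
    by apply: (coded_inj rho01 C0 ha) => n; rewrite gP fP.
  by apply: (coded_inj rho01 C'0 ha') => n; rewrite fP gP.
Qed.

Lemma bilipschitz_coded (R : realType) (T T' : metricType R) (rho : R) M :
  bilipschitz_equivalent T T' -> coded rho M T -> coded rho M T'.
Proof.
move=> [f [K [[g fK gK] K0 fP]]] [h [C [C0 hs ha hd]]].
exists (h \o g), (K * C); split; first exact: mulr_gt0.
- by move=> u; have [x xu] := hs u; exists (f x) => n /=; rewrite fK.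
- move=> x y n xy; rewrite -{1}(gK x) -{1}(gK y).
  have /andP[_] := fP (g x) (g y); move=> /le_trans; apply.
  by rewrite -mulrA ler_pM2l// ha.
- move=> x y n /hd /le_trans; apply.
  rewrite [K * C]mulrC -mulrA ler_pM2l// -{2}(gK x) -{2}(gK y).
  by have /andP[+ _] := fP (g x) (g y); rewrite ler_pdivrMl.
Qed.

(** * Relations and packings *)

Section Relations.
Variable I : finType.
Implicit Types A B : {set I * I}.

Definition relc A B := [set x : I * I | [exists k, ((x.1, k) \in A) && ((k, x.2) \in B)]]%SET.

Lemma relcP A B i j : reflect (exists2 k, (i, k) \in A & (k, j) \in B) ((i, j) \in relc A B).
Proof.
rewrite inE /=; apply: (iffP existsP) => [[k /andP[]]|[k kA kB]]; first by exists k.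
by exists k; rewrite kA.
Qed.

Lemma relcA A B D : relc A (relc B D) = relc (relc A B) D.
Proof.
apply/setP => -[i j]; apply/relcP/relcP => [[k ik /relcP[l kl lj]]|[k /relcP[l il lk] kj]].
  by exists l => //; apply/relcP; exists k.
by exists l => //; apply/relcP; exists k.
Qed.

(** Indexed from zero: [relpow A n] is the power of exponent [n.+1]. *)
Fixpoint relpow A n := if n is k.+1 then relc A (relpow A k) else A.

Lemma relpowD A a b : relc (relpow A a) (relpow A b) = relpow A (a + b).+1.
Proof. by elim: a => [//|a IH] /=; rewrite -relcA IH. Qed.

(** The powers are eventually periodic by pigeonhole, and a power whose exponent is a large multiple
    of the period is idempotent. *)
Lemma relpow_idempotent A : exists n, relc (relpow A n) (relpow A n) = relpow A n.
Proof.
have [a [d [d0 ad]]] : exists a d, (0 < d)%N /\ relpow A a = relpow A (a + d).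
  pose f (i : 'I_#|{set I * I}|.+1) := relpow A i.
  have /injectivePn[x [y xy fxy]] : ~~ injectiveb f.
    by apply/negP => /injectiveP/leq_card; rewrite card_ord ltnn.
  wlog lxy : x y xy fxy / (x < y)%N.
    move=> th; case: (ltngtP x y) => [|yx|/ord_inj/eqP]; [exact: th| |by rewrite (negPf xy)].
    by apply: (th y x) => //; rewrite eq_sym.
  exists x, (y - x)%N; split; first by rewrite subn_gt0.
  rewrite subnKC; [exact: fxy|exact: ltnW lxy].
have pn k : relpow A (a + k) = relpow A (a + k + d).
  elim: k => [|k IH]; first by rewrite addn0.
  by rewrite addnS addSn /= IH.
have pkd k n : (a <= n)%N -> relpow A n = relpow A (n + k * d).
  move=> an; elim: k => [|k IH]; first by rewrite addn0.
  have -> : (n + k.+1 * d = a + (n - a + k * d) + d)%N by lia.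
  by rewrite -pn IH; congr relpow; lia.
(* The exponent [a.+1 * d] lies past the preperiod, and doubling it adds [a.+1] whole periods. *)
have aN : (a <= (a.+1 * d).-1)%N by nia.
exists (a.+1 * d).-1; rewrite relpowD [RHS](pkd a.+1 _ aN); congr relpow.
by nia.
Qed.

End Relations.

Section Packing.
Variable I : finType.
Implicit Types (C : {set I}) (w n : I -> nat).

(** The least positive integer combination of the weights divides each of them, since a remainder is
    again a combination. *)
Lemma bezout_family C w i : i \in C -> (forall t, t \in C -> (0 < w t)%N) ->
  exists g, [/\ (0 < g)%N, forall t, t \in C -> (g %| w t)%N &
    exists z : I -> int, \sum_(t in C) z t * (w t)%:Z = g%:Z].
Proof.
move=> iC w0; pose P (g : nat) := `[< (0 < g)%N /\ exists z : I -> int, \sum_(t in C) z t * (w t)%:Z = g%:Z >].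
have delta t : t \in C -> \sum_(s in C) (s == t)%:Z * (w s)%:Z = (w t)%:Z.
  move=> tC; rewrite (bigD1 t)//= eqxx mul1r big1 ?addr0// => s /andP[_ /negPf->].
  by rewrite mul0r.
have exP : exists g, P g.
  by exists (w i); apply/asboolP; split; [exact: w0|exists (fun s => (s == i)%:Z); exact: delta].
case: (ex_minnP exP) => g /asboolP[g0 [z zg]] gmin.
exists g; split => //; last by exists z.
move=> t tC; rewrite /dvdn; apply: contraT; rewrite -lt0n => m0.
suff /gmin : P (w t %% g)%N by rewrite leqNgt ltn_mod g0.
apply/asboolP; split => //.
exists (fun s => (s == t)%:Z - (w t %/ g)%N%:Z * z s).
under eq_bigr do rewrite mulrBl -mulrA.
rewrite sumrB delta// -mulr_sumr zg.
by have := divn_eq (w t) g; lia.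
Qed.

(* Up to a bounded correction, [x] is [n / k]; a Bezout relation with coefficients
   [z] corrects the mass to be exactly [m]. *)
Lemma packing C w (z : I -> int) V : \sum_(t in C) z t * (w t)%:Z = 1 ->
  exists B, forall n k m, (0 < k <= V)%N -> (forall t, t \in C -> (B <= n t)%N) ->
    (\sum_(t in C) n t * w t = k * m)%N ->
    exists2 x : I -> nat, (\sum_(t in C) x t * w t = m)%N &
      forall t, t \in C -> (k.-1 * x t <= n t)%N.
Proof.
move=> zw; pose H := (\sum_(t in C) w t)%N; pose Z := (\sum_(t in C) `|z t|)%N.
(* [H * Z] bounds the correction [h * |z t|]. One factor [V] absorbs the division by [k], the other
   pays for [k.-1] copies of the correction. *)
exists (V * (V * (H * Z)))%N => n k m /andP[k0 kV] nB nm.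
pose q t := (n t %/ k)%N.
have qw : (\sum_(t in C) q t * w t <= m)%N.
  rewrite -(leq_pmul2l k0) -nm big_distrr /=; apply: leq_sum => t _.
  by rewrite mulnA leq_mul2r (mulnC k) leq_divM orbT.
(* The mass lost in rounding down, at most one [w t] per type; adding [h * z t] to [q t] restores
   exactly this mass. *)
pose h := (m - \sum_(t in C) q t * w t)%N.
have hH : (h <= H)%N.
  rewrite -(leq_pmul2l k0) mulnBr -nm leq_subLR !big_distrr -big_split /=.
  apply: leq_sum => t _; rewrite mulnA -mulnDl leq_mul2r; apply/orP; right.
  by have := divn_eq (n t) k; have := ltn_pmod (n t) k0; rewrite /q; lia.
have qB t : t \in C -> (V * (h * `|z t|) <= q t)%N.
  move=> tC; rewrite /q leq_divRL//.
  apply: leq_trans (nB _ tC); rewrite -mulnA leq_mul// mulnC leq_mul// leq_mul//.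
  by rewrite /Z (bigD1 t)//= leq_addr.
have xE t : t \in C -> exists x : nat, x%:Z = (q t)%:Z + h%:Z * z t.
  move=> tC; have := qB t tC; set hz := (h * _)%N => hq.
  have : (hz <= q t)%N by nia.
  move=> hzq; exists (absz ((q t)%:Z + h%:Z * z t)); rewrite gez0_abs//.
  have : `|h%:Z * z t| = hz%:Z by rewrite normrM /hz; lia.
  by lia.
have /choice[x xP] : forall t, exists x : nat, t \in C -> x%:Z = (q t)%:Z + h%:Z * z t.
  move=> t; case: (boolP (t \in C)) => [/xE[x xt]|_]; [by exists x|by exists 0%N].
exists x => [|t tC].
  apply/eqP; rewrite -eqz_nat; apply/eqP.
  have -> : (\sum_(t in C) x t * w t)%N%:Z = \sum_(t in C) (x t)%:Z * (w t)%:Z.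
    by rewrite -natz natr_sum; apply: eq_bigr => t _; rewrite natrM !natz.
  have -> : \sum_(t in C) (x t)%:Z * (w t)%:Z =
            (\sum_(t in C) q t * w t)%N%:Z + h%:Z * (\sum_(t in C) z t * (w t)%:Z).
    rewrite -natz natr_sum mulr_sumr -big_split; apply: eq_bigr => t tC.
    by rewrite /= xP// mulrDl natrM !natz mulrA.
  by rewrite zw mulr1 /h; lia.
rewrite -lez_nat PoszM xP//.
have := qB t tC; set hz := (h * _)%N => hq.
have : `|h%:Z * z t| = hz%:Z by rewrite normrM /hz; lia.
have : (k * q t <= n t)%N by rewrite /q mulnC leq_divM.
rewrite mulrDr.
have kk : k = k.-1.+1 by lia.
have : (k.-1 * hz <= q t)%N by apply: leq_trans hq; rewrite leq_mul//; lia.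
move: (h%:Z * z t) => y; rewrite {2}kk; move: (k.-1) => k'; nia.
Qed.

Lemma subset_of_card (T : finType) (A : {set T}) k : (k <= #|A|)%N ->
  exists2 B : {set T}, (B \subset A)%SET & #|B| = k.
Proof.
move=> kA; exists [set x in take k (enum A)]%SET.
  by apply/fintype.subsetP => x; rewrite inE => /mem_take; rewrite mem_enum.
rewrite cardsE -[RHS](size_takel (s := enum A)) -?cardE//.
by apply/card_uniqP; rewrite take_uniq// enum_uniq.
Qed.

End Packing.

(** * Powers of a graph-directed system *)

Section GraphPowers.
Variable p : nat.
Implicit Types G H : multidigraph p.

Definition comp_graph G H : multidigraph p :=
  @Multidigraph p {x in [set x : edge G * edge H | tgt x.1 == src x.2]%SET}
    (fun x => src (val x).1) (fun x => tgt (val x).2).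

(** The edges of [pow_graph G n] are the paths of length [n.+1]. *)
Fixpoint pow_graph G n := if n is k.+1 then comp_graph G (pow_graph G k) else G.

(** The adjacency matrix applied to the vector [w], in natural numbers. *)
Definition wsum G (w : 'I_p -> nat) i := (\sum_(e : edge G | src e == i) w (tgt e))%N.

Definition reach G := [set x : 'I_p * 'I_p | [exists e : edge G, (src e, tgt e) == x]]%SET.

Lemma reachP G i j : reflect (exists e : edge G, src e = i /\ tgt e = j) ((i, j) \in reach G).
Proof.
rewrite inE; apply: (iffP existsP) => [[e /eqP[<- <-]]|[e [<- <-]]]; by exists e.
Qed.

Lemma wsum_comp G H w i : wsum (comp_graph G H) w i = wsum G (wsum H w) i.
Proof.
rewrite /wsum /= -(big_sub_cond _ (fun x : edge G * edge H => src x.1 == i) (fun x => w (tgt x.2))).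
rewrite pair_big_dep /=; apply: eq_bigl => -[e f] /=.
by rewrite inE /= andbC [src f == _]eq_sym.
Qed.

Lemma reach_comp G H : reach (comp_graph G H) = relc (reach G) (reach H).
Proof.
apply/setP => -[i j]; apply/reachP/relcP.
  move=> [[[e f] /= ef] [<- <-]]; exists (tgt e); apply/reachP; first by exists e.
  by exists f; move: ef; rewrite inE /= => /eqP ->.
move=> [k /reachP[e [ei ek]] /reachP[f [fk fj]]].
have ef : (e, f) \in [set x : edge G * edge H | tgt x.1 == src x.2]%SET.
  by rewrite inE /= ek fk.
by exists (exist _ (e, f) ef).
Qed.

Lemma reach_pow G n : reach (pow_graph G n) = relpow (reach G) n.
Proof. by elim: n => [//|n IH] /=; rewrite reach_comp IH. Qed.

Lemma wsum_gt0 G w i j : (i, j) \in reach G -> (w j <= wsum G w i)%N.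
Proof.
by move/reachP => [e [<- <-]]; rewrite /wsum (bigD1 e)//= leq_addr.
Qed.

Lemma leq_wsum G w w' i : (forall j, (i, j) \in reach G -> w j <= w' j)%N ->
  (wsum G w i <= wsum G w' i)%N.
Proof. by move=> ww; apply: leq_sum => e /eqP ei; apply: ww; apply/reachP; exists e. Qed.

Lemma eq_wsum G w w' i : (forall j, (i, j) \in reach G -> w j = w' j) ->
  wsum G w i = wsum G w' i.
Proof. by move=> ww; apply: eq_bigr => e /eqP ei; apply: ww; apply/reachP; exists e. Qed.

Lemma wsumZ G a w i : wsum G (fun j => a * w j)%N i = (a * wsum G w i)%N.
Proof. by rewrite /wsum big_distrr. Qed.

Lemma wsum_pow G m w n : (forall i, wsum G w i = m * w i)%N ->
  forall i, wsum (pow_graph G n) w i = (m ^ n.+1 * w i)%N.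
Proof.
move=> wm; elim: n => [|n IH] i /=; first by rewrite expn1.
by rewrite wsum_comp (eq_wsum (fun j _ => IH j)) wsumZ wm mulnA -expnSr.
Qed.

Lemma wsum_cond G (P : pred 'I_p) i :
  wsum G (fun j => P j : nat) i = #|[set e : edge G | (src e == i) && P (tgt e)]%SET|.
Proof.
rewrite -sum1_card /wsum big_mkcond [RHS]big_mkcond /=; apply: eq_bigr => e _.
by rewrite inE; case: eqP; case: (P _).
Qed.

End GraphPowers.

Section GraphSystem.
Variables (R : realType) (X : metricType R) (p : nat).
Implicit Types (G H : multidigraph p).

Definition comp_maps G H (S : edge G -> X -> X) (T : edge H -> X -> X)
  (x : edge (comp_graph G H)) : X -> X := S (val x).1 \o T (val x).2.

Fixpoint pow_maps G (S : edge G -> X -> X) n : edge (pow_graph G n) -> X -> X :=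
  if n is k.+1 then comp_maps S (@pow_maps G S k) else S.

(** The family [K] stays fixed while the graph varies: the same sets solve the system of every power
    of the graph. *)
Definition gsystem (rho : R) (K : 'I_p -> set X) G (S : edge G -> X -> X) :=
  [/\ forall e, similarity rho (S e),
      forall i, K i = \bigcup_(e in [set e | src e = i]) (S e @` K (tgt e)) &
      forall e f, src e = src f -> e != f ->
        S e @` K (tgt e) `&` S f @` K (tgt f) = set0].

Lemma similarity_inj (s : R) (f : X -> X) : 0 < s -> similarity s f -> injective f.
Proof.
move=> s0 fs x y fxy; apply/eqP; rewrite -[_ == _]negbK -mdist_gt0.
by rewrite -(pmulr_rgt0 _ s0) -fs fxy mdistxx ltxx.
Qed.

(** Distinct composable pairs differ in the first edge, where [S] gives disjointness, or only in the
    second, where [T] does and [S e] is injective. *)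
Lemma gsystem_comp (rho rho' : R) K G H (S : edge G -> X -> X) (T : edge H -> X -> X) :
  0 < rho -> gsystem rho K S -> gsystem rho' K T ->
  gsystem (rho * rho') K (comp_maps S T).
Proof.
move=> rho0 [sS KS dS] [sT KT dT]; split.
- by move=> x; exact: similarity_comp.
- move=> i; apply/seteqP; split => [x|x [[[e f] /= ef] /= ei [y Ky <-]]].
    rewrite {1}KS => -[e /= ei [y]]; rewrite {1}KT => -[f /= fe [z Kz <-] <-].
    have ef : (e, f) \in [set x : edge G * edge H | tgt x.1 == src x.2]%SET.
      by rewrite inE /= fe.
    by exists (exist _ (e, f) ef) => //; exists z.
  have /eqP te : tgt e == src f by move: (ef) => {ef}; rewrite inE.
  rewrite KS; exists e => //; exists (T f y) => //.
  by rewrite KT; exists f => //; exists y.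
- move=> [[e f] /= ef] [[e' f'] /= ef'] /= see' ne.
  have /eqP te : tgt e == src f by move: (ef) => {ef ne}; rewrite inE.
  have /eqP te' : tgt e' == src f' by move: (ef') => {ef' ne}; rewrite inE.
  have [ee'|ee'] := eqVneq e e'.
    subst e'; have ff' : f != f'.
      apply: contraNneq ne => ff'; subst f'.
      by apply/eqP; apply: val_inj.
    apply/seteqP; split => // _ [[y Ky <-] [z Kz]].
    rewrite /comp_maps /= => /(similarity_inj rho0 (sS e)) Tyz.
    have : (T f @` K (tgt f) `&` T f' @` K (tgt f')) (T f y).
      by split; [exists y|exists z].
    by rewrite dT// -te -te'.
  apply/seteqP; split => // _ [[y Ky <-] [z Kz]].
  rewrite /comp_maps /= => Syz.
  have : (S e @` K (tgt e) `&` S e' @` K (tgt e')) (S e (T f y)).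
    split; first by exists (T f y) => //; rewrite KT te; exists f => //; exists y.
    by exists (T f' z) => //; rewrite KT te'; exists f' => //; exists z.
  by rewrite dS.
Qed.

Lemma gsystem_pow (rho : R) K G (S : edge G -> X -> X) n :
  0 < rho -> gsystem rho K S -> gsystem (rho ^+ n.+1) K (@pow_maps G S n).
Proof.
move=> rho0 sS; elim: n => [|n IH] /=; first by rewrite expr1.
by rewrite exprS; exact: gsystem_comp.
Qed.

Lemma compact_sep (A B : set X) : compact A -> compact B -> A `&` B = set0 ->
  exists2 c, 0 < c & sep c A B.
Proof.
move=> cA cB AB0.
have clB : closed B by apply: compact_closed => //; exact: metric_hausdorff.
have : \forall c \near 0^'+, A `<=` (fun x => forall y, B y -> c <= mdist x y).
  move/compact_near_coveringP : cA; apply => x Ax.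
  have : nbhs x (~` B).
    apply: open_nbhs_nbhs; split; first exact: closed_openC.
    by move=> Bx; have : (A `&` B) x by []; rewrite AB0.
  move/metricType_numDomainType.nbhs_mdistP => -[d /= d0 dB].
  exists ([set x' | mdist x x' < d / 2], [set c | c < d / 2]) => /=.
    split.
      by apply/metricType_numDomainType.nbhs_mdistP; exists (d / 2) => //=; rewrite divr_gt0.
    by apply: nbhs_right_lt; rewrite divr_gt0.
  move=> [x' c] /= [xx' cd] y By; rewrite leNgt; apply/negP => x'y.
  apply: (dB y) By => /=.
  rewrite (le_lt_trans (metric_triangle x x' y))// [ltRHS]splitr ltrD//.
  exact: lt_trans cd.
move=> nc; near (0 : R)^'+ => c; have Ac : A `<=` (fun x => forall y, B y -> c <= mdist x y) by near: c.
by exists c => // x y /Ac; exact.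
Unshelve. all: by end_near. Qed.

Lemma compact_diam_le (A : set X) : compact A -> exists D, diam_le D A.
Proof.
move=> cA; have [[x0 _]|A0] := pselect (A !=set0); last first.
  by exists 0 => x y Ax; exfalso; apply: A0; exists x.
have : \forall c \near +oo, A `<=` (fun x => mdist x0 x <= c).
  move/compact_near_coveringP : cA; apply => x Ax.
  exists ([set x' | mdist x x' < 1], [set c | mdist x0 x + 1 < c]) => /=.
    split.
      by apply/metricType_numDomainType.nbhs_mdistP; exists 1 => //=.
    by apply: nbhs_pinfty_gt; rewrite num_real.
  move=> [x' c] /= [xx' cd]; apply: le_trans (ltW cd).
  by rewrite (le_trans (metric_triangle x0 x x'))// lerD2l ltW.
move=> nc; near (+oo_R) => c.
have Ac : A `<=` (fun x => mdist x0 x <= c) by near: c.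
exists (c + c) => x y Ax Ay.
apply: le_trans (metric_triangle x x0 y) (lerD _ _); last exact: Ac.
by rewrite metric_sym; exact: Ac.
Unshelve. all: by end_near. Qed.

End GraphSystem.

Lemma finite_lower_bound (R : realType) (T : finType) (P : T -> R -> Prop) :
  (forall t c c', c' <= c -> P t c -> P t c') ->
  (forall t, exists2 c, 0 < c & P t c) -> exists2 c, 0 < c & forall t, P t c.
Proof.
move=> mono ex.
have /choice[f fP] : forall t, exists c, 0 < c /\ P t c.
  by move=> t; have [c c0 Pc] := ex t; exists c.
exists (\big[Num.min/1]_t f t).
  by apply: lt_bigmin => // t _; have [] := fP t.
move=> t; have [_] := fP t; apply: mono.
exact: bigmin_le.
Qed.

Lemma finite_upper_bound (R : realType) (T : finType) (P : T -> R -> Prop) :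
  (forall t c c', 0 < c -> c <= c' -> P t c -> P t c') ->
  (forall t, exists2 c, 0 < c & P t c) -> exists2 c, 0 < c & forall t, P t c.
Proof.
move=> mono ex.
have [||c c0 Pc] := @finite_lower_bound R T (fun t c => 0 < c -> P t c^-1).
- move=> t c c' cc Pt c'0; have c0 := lt_le_trans c'0 cc.
  apply: mono (Pt c0); first by rewrite invr_gt0.
  by rewrite lef_pV2.
- move=> t; have [c c0 Pt] := ex t; exists c^-1; first by rewrite invr_gt0.
  by rewrite invrK.
exists c^-1; first by rewrite invr_gt0.
by move=> t; exact: Pc.
Qed.

Lemma gsystem_sep (R : realType) (X : metricType R) p (rho : R)
    (K : 'I_p -> set X) (G : multidigraph p) (S : edge G -> X -> X) :
  0 < rho -> (forall i, compact (K i)) -> gsystem rho K S ->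
  exists2 c, 0 < c & forall e f, src e = src f -> e != f ->
    sep c (S e @` K (tgt e)) (S f @` K (tgt f)).
Proof.
move=> rho0 cK [sS _ dS].
have [||c c0 Pc] := @finite_lower_bound R (edge G * edge G)%type (fun ef c =>
    src ef.1 = src ef.2 -> ef.1 != ef.2 -> sep c (S ef.1 @` K (tgt ef.1)) (S ef.2 @` K (tgt ef.2))).
- by move=> ef c c' cc s se ne; apply: sep_sub (s se ne).
- move=> [e f] /=.
  have [[se ne]|nse] := pselect (src e = src f /\ e != f); last first.
    by exists 1 => // se ne; exfalso; apply: nse.
  have [c c0 sc] : exists2 c, 0 < c & sep c (S e @` K (tgt e)) (S f @` K (tgt f)).
    apply: compact_sep; [exact: similarity_compact (sS e) (cK _)|
      exact: similarity_compact (sS f) (cK _)|exact: dS].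
  by exists c.
by exists c => // e f; exact: (Pc (e, f)).
Qed.

(** * Recurrent and transient vertices *)

Section GraphMary.
Variables (R : realType) (X : metricType R) (p : nat) (rho : R) (M : nat).
Variables (K : 'I_p -> set X) (G : multidigraph p) (S : edge G -> X -> X).
Hypotheses (rho01 : 0 < rho < 1) (M2 : (2 <= M)%N).
Hypotheses (cX : compact [set: X]) (cK : forall i, compact (K i)).
Hypotheses (K0 : forall i, K i !=set0) (sysG : gsystem rho K S).
Local Notation mary := (@mary R X rho M).
Implicit Types (F : {set edge G}).

Let rho0 : 0 < rho. Proof. by case/andP: rho01. Qed.
Let rle1 : rho <= 1. Proof. by case/andP: rho01 => _ /ltW. Qed.

Definition out i := [set e : edge G | src e == i]%SET.

Definition piece_of F := \bigcup_(e in [set` F]) (S e @` K (tgt e)).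

Lemma piece_of_out i : piece_of (out i) = K i.
Proof.
have [_ KS _] := sysG; rewrite [RHS]KS; congr bigcup.
by apply/seteqP; split => e /=; rewrite inE => /eqP.
Qed.

Lemma piece_ofU F F' : piece_of (F :|: F')%SET = piece_of F `|` piece_of F'.
Proof.
apply/seteqP; split => [x [e /=]|x [[e /= eF Kx]|[e /= eF Kx]]].
- by rewrite inE => /orP[eF|eF] Kx; [left|right]; exists e.
- by exists e => //=; rewrite inE eF.
- by exists e => //=; rewrite inE eF orbT.
Qed.

Lemma piece_of_sep : exists2 c, 0 < c & forall F F' i, (F \subset out i)%SET ->
  (F' \subset out i)%SET -> [disjoint F & F']%bool -> sep c (piece_of F) (piece_of F').
Proof.
have [c c0 sc] := gsystem_sep rho0 cK sysG; exists c => // F F' i Fi F'i dF.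
move=> x y [e /= eF Kx] [f /= fF' Ky]; apply: sc Kx Ky.
  have := fintype.subsetP Fi e eF; have := fintype.subsetP F'i f fF'.
  by rewrite !inE => /eqP-> /eqP->.
by apply: contraTneq dF => ef; apply/pred0Pn; exists e; rewrite /= eF ef.
Qed.

Lemma piece_of_compact F : compact (piece_of F).
Proof.
have [sS _ _] := sysG.
apply: (@parts_compact _ _ (@compact X) 0 (\sum_(e in F) 1)) => //.
apply: (@parts_bigcup_fin _ _ _ _ _ F (fun e => S e @` K (tgt e)) (fun=> 1%N)).
- move=> e _; apply: parts1; exact: similarity_compact rho0 (sS e) (@cK _).
- by move=> e f _ _ _ x y _ _; exact: mdist_ge0.
Qed.

Lemma piece_of_nonempty F e : e \in F -> piece_of F !=set0.
Proof. by move=> eF; have [x Kx] := K0 (tgt e); exists (S e x), e => //; exists x. Qed.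

Section Recurrent.
Variables (C : {set 'I_p}) (w : 'I_p -> nat).
Hypotheses (closedC : forall e : edge G, src e \in C -> tgt e \in C).
Hypotheses (w0 : forall i, i \in C -> (0 < w i)%N).
Hypotheses (wM : forall i, i \in C -> (\sum_(e in out i) w (tgt e) = w i * M)%N).
Hypotheses (wpack : forall i, i \in C -> exists2 x : 'I_p -> nat,
  (\sum_(t in C) x t * w t = M)%N &
  forall t, t \in C -> ((w i).-1 * x t <= #|edges G i t|)%N).

(* The pieces of mass exactly [M] cut out of the [K i]; they form a new
   graph-directed family in which every piece has exactly [M] children. *)
Definition unit_piece (Q : set X) := exists i F,
  [/\ i \in C, (F \subset out i)%SET, (\sum_(e in F) w (tgt e) = M)%N & Q = piece_of F].

(** The profile [x] prescribes how many edges to each vertex a unit takes. Units of this profile are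
    peeled off [k.-1] times; the remaining edges have mass [M] and form the last unit, whatever
    their profile. *)
Lemma unit_piece_peel c i (x : 'I_p -> nat) : i \in C ->
  (forall F F' i, (F \subset out i)%SET -> (F' \subset out i)%SET ->
     [disjoint F & F']%bool -> sep c (piece_of F) (piece_of F')) ->
  (\sum_(t in C) x t * w t = M)%N ->
  forall k F, (0 < k)%N -> (F \subset out i)%SET ->
    (\sum_(e in F) w (tgt e) = k * M)%N ->
    (forall t, t \in C -> k.-1 * x t <= #|F :&: edges G i t|)%N ->
  parts unit_piece c k (piece_of F).
Proof.
move=> iC sc xM; case=> // k F _; elim: k F => [|k IH] F Fi FM Fx.
  by apply: parts1; exists i, F; rewrite FM mul1n.
have /choice[A AP] : forall t, exists A : {set edge G}, t \in C ->
    (A \subset F :&: edges G i t)%SET /\ #|A| = x t.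
  move=> t; case: (boolP (t \in C)) => [tC|_]; last by exists finset.set0.
  have xF : (x t <= #|F :&: edges G i t|)%N.
    by apply: leq_trans (Fx t tC) => /=; rewrite leq_pmull.
  by have [A AF Ax] := subset_of_card xF; exists A.
pose F' := [set e in F | e \in A (tgt e)]%SET.
have F'F : (F' \subset F)%SET by apply/fintype.subsetP => e; rewrite inE => /andP[].
have F'A t : t \in C -> (F' :&: edges G i t = A t)%SET.
  move=> /AP[At _]; apply/setP => e; rewrite !inE.
  apply/idP/idP => [/andP[/andP[_ eA] /andP[_ /eqP te]]|eA]; first by rewrite -te.
  have := fintype.subsetP At e eA; rewrite !inE => /and3P[-> -> /eqP te].
  by rewrite te eA eqxx.
have tgC e : e \in F -> tgt e \in C.
  move=> eF; apply: closedC; have := fintype.subsetP Fi e eF.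
  by rewrite inE => /eqP->.
have F'M : (\sum_(e in F') w (tgt e) = M)%N.
  rewrite (partition_big (fun e : edge G => tgt e) (mem C)) => [|e eF]; last first.
    by apply: tgC; exact: (fintype.subsetP F'F).
  rewrite -xM; apply: eq_bigr => t tC.
  rewrite (eq_bigr (fun=> w t)) => [|e /andP[_ /eqP<-]//].
  rewrite sum_nat_const; congr (_ * _)%N.
  have [_ <-] := AP t tC; rewrite -(F'A t tC); apply: eq_card => e.
  rewrite !inE unfold_in /= inE.
  apply/idP/idP => [/andP[/andP[eF eA] te]|].
    by have := fintype.subsetP Fi e eF; rewrite inE eF eA te => ->.
  by move=> /andP[/andP[-> ->] /andP[_ ->]].
have FE : F = (F' :|: F :\: F')%SET.
  by apply/setP => e; rewrite !inE; case: (e \in F); case: (e \in A _).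
rewrite FE piece_ofU -[k.+2]add1n; apply: partsU.
- apply: parts1; exists i, F'; split => //.
  exact: fintype.subset_trans Fi.
- apply: IH.
  + by apply: fintype.subset_trans Fi; exact: finset.subsetDl.
  + move: FM; rewrite (big_setID F')/= (finset.setIidPr F'F) F'M mulSn.
    by move/addnI.
  + move=> t tC; have := Fx t tC; rewrite /= mulSn.
    have -> : (F :&: edges G i t = (F' :&: edges G i t) :|: ((F :\: F') :&: edges G i t))%SET.
      by rewrite -finset.setIUl -FE.
    move=> h; have := leq_trans h (leq_card_setU _ _).
    by rewrite F'A//; have [_ ->] := AP t tC; rewrite leq_add2l.
- apply: (sc _ _ i).
  + exact: fintype.subset_trans Fi.
  + by apply: fintype.subset_trans Fi; exact: finset.subsetDl.
  + by rewrite finset.disjoints_subset; apply/fintype.subsetP => e; rewrite !inE negb_and negbK => ->.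
Qed.

(** An edge [e] of a unit carries [w (tgt e)] scaled units and the masses add up to [M], so a unit
    splits into [M] similar units. Each [K i] is then glued from its [w i] units. *)
Lemma recurrent_mary : exists2 c, 0 < c & forall i, i \in C -> mary c 0 (K i).
Proof.
have [c c0 sc] := piece_of_sep; have [D DX] := compact_diam_le cX.
have [sS _ _] := sysG.
have KP i : i \in C -> parts unit_piece c (w i) (K i).
  move=> iC; have [x xM xi] := wpack iC; rewrite -piece_of_out.
  apply: (unit_piece_peel iC sc xM) => //; [exact: w0|exact: wM|].
  move=> t tC; apply: leq_trans (xi t tC) (subset_leq_card _).
  by apply/fintype.subsetP => e; rewrite !inE => /andP[-> ->].
have [C1 C10 mQ] : exists2 C1, 0 < C1 & forall Q, unit_piece Q -> mary C1 0 Q.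
  apply: (@mary_of_similar_pieces R X rho M rho01 unit_piece 1 (rho * c) D) => //.
    exact: mulr_gt0.
  move=> _ [i [F [iC Fi FM ->]]]; split; first exact: piece_of_compact.
    have [e eF] : exists e, e \in F.
      apply/existsP; apply: contraT; rewrite negb_exists => /forallP F0.
      by move: FM; rewrite big_pred0; [move: M2; case: M|move=> e; exact/negbTE].
    exact: piece_of_nonempty eF.
  rewrite -[X in parts _ _ X _]FM; apply: parts_bigcup_fin.
    move=> e eF; have tC : tgt e \in C.
      by apply: closedC; have := fintype.subsetP Fi e eF; rewrite inE => /eqP->.
    apply: parts_image (ltW rho0) (sS e) _ (KP _ tC) => B uB.
    by left; exists (S e), B.
  move=> e f eF fF ef; apply: (@sep_sub _ _ c _ (piece_of [set e]%SET) _ (piece_of [set f]%SET)).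
  - by rewrite ler_piMl// ltW.
  - by move=> x Kx; exists e => //=; rewrite inE.
  - by move=> x Kx; exists f => //=; rewrite inE.
  - apply: (sc _ _ i); rewrite ?finset.sub1set ?(fintype.subsetP Fi)//.
    by rewrite disjoints1 inE.
pose C2 := C1 + c^-1 + `|D|.
have C20 : 0 < C2 by rewrite !ltr_wpDr ?invr_ge0 ?(ltW c0).
have := @finite_upper_bound R 'I_p (fun i c => i \in C -> mary c 0 (K i)).
apply; first by move=> i c1 c2 c10 c12 m1 /m1; exact: mary_le.
move=> i; have [iC|iC] := boolP (i \in C); last by exists 1.
have [C3 C30 glue] := mary_glue X rho01 M2 (w0 iC) C20.
exists C3 => // _; apply: glue.
  apply: sub_parts (KP i iC) => [B /mQ|].
    by apply: mary_le => //; rewrite /C2 -addrA lerDl addr_ge0// invr_ge0 ltW.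
  rewrite expr0 mul1r -[leRHS]invrK lef_pV2 ?posrE ?invr_gt0//.
  by rewrite /C2 addrAC lerDr addr_ge0// ltW.
move=> x y _ _; rewrite expr0 mulr1 (le_trans (DX x y _ _))// (le_trans (ler_norm D))//.
by rewrite /C2 lerDr addr_ge0 ?invr_ge0 ?(ltW c0) ?(ltW C10).
Qed.

End Recurrent.

Section Transient.
Variables (Gd : {set 'I_p}) (C0 : R).
Hypotheses (C00 : 0 < C0) (mGd : forall i, i \in Gd -> mary C0 0 (K i)).
Hypothesis fewbad : forall i, i \notin Gd ->
  (#|[set e in out i | tgt e \notin Gd]%SET| < M)%N.
Hypothesis somegood : forall i, i \notin Gd -> exists2 e, e \in out i & tgt e \in Gd.

(** At a vertex outside [Gd], each edge leaving [Gd] aside gives one child similar to a set of the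
    same kind; the missing [M - #|bd i|] children come from gluing the edges into [Gd] and cutting
    the result again. *)
Lemma transient_mary : exists2 c, 0 < c & forall i, mary c 0 (K i).
Proof.
have [c c0 sc] := piece_of_sep; have [D DX] := compact_diam_le cX.
have [sS _ _] := sysG.
pose gd i := [set e in out i | tgt e \in Gd]%SET.
pose bd i := [set e in out i | tgt e \notin Gd]%SET.
have gdi i : (gd i \subset out i)%SET by apply/fintype.subsetP => e; rewrite inE => /andP[].
have bdi i : (bd i \subset out i)%SET by apply/fintype.subsetP => e; rewrite inE => /andP[].
have sce i e f : e \in out i -> f \in out i -> e != f -> sep c (S e @` K (tgt e)) (S f @` K (tgt f)).
  move=> ei fi ef; apply: (@sep_sub _ _ c _ (piece_of [set e]%SET) _ (piece_of [set f]%SET)) => //.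
  - by move=> x Kx; exists e => //=; rewrite inE.
  - by move=> x Kx; exists f => //=; rewrite inE.
  - by apply: (sc _ _ i); rewrite ?finset.sub1set// disjoints1 inE.
(* Chosen for level one: [rho / C1 <= c] for the gaps and [D <= C1 * rho] for the diameters. *)
pose C1 := C0 + rho / c + `|D| / rho.
have C10 : 0 < C1 by rewrite !ltr_wpDr ?divr_ge0 ?(ltW c0) ?(ltW rho0).
have [C3 C30 pgd] : exists2 C3, 0 < C3 & forall i, i \notin Gd ->
    parts (mary C3 1) (rho / C3) (M - #|bd i|) (piece_of (gd i)).
  apply: (@finite_upper_bound R 'I_p (fun i C3 => i \notin Gd ->
    parts (mary C3 1) (rho / C3) (M - #|bd i|) (piece_of (gd i)))).
    move=> i c1 c2 c10 c12 m1 /m1; apply: sub_parts => [B|]; first exact: mary_le.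
    by rewrite ler_pM2l// lef_pV2// posrE (lt_le_trans c10).
  move=> i; have [iC|iC] := boolP (i \in Gd); first by exists 1.
  have gd0 : (0 < #|gd i|)%N.
    by apply/card_gt0P; have [e ei eG] := somegood iC; exists e; rewrite inE ei.
  have bdM : (0 < M - #|bd i|)%N by rewrite subn_gt0 fewbad.
  have [C2 C20 glue] := mary_glue X rho01 M2 gd0 C10.
  have [C3 C30 part] := mary_partition X rho01 M2 bdM C20.
  exists C3 => // _; rewrite -[X in X / C3]expr1; apply: part; apply: glue; last first.
    move=> x y _ _; rewrite expr1 (le_trans (DX x y _ _))// (le_trans (ler_norm D))//.
    rewrite /C1 mulrDl divfK ?lt0r_neq0// lerDr.
    by rewrite mulr_ge0 ?addr_ge0 ?divr_ge0 ?(ltW c0) ?(ltW rho0) ?(ltW C00).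
  rewrite -sum1_card; apply: parts_bigcup_fin.
    move=> e; rewrite inE => /andP[ei eG]; apply: parts1.
    have := @mary_image _ _ _ _ rho01 C1 0 1 (S e) (K (tgt e)).
    rewrite addn0 expr1; apply; first exact: sS.
    by apply: mary_le (mGd eG) => //; rewrite /C1 -addrA lerDl addr_ge0// divr_ge0// ltW.
  move=> e f; rewrite !inE => /andP[ei eG] /andP[fi fG] ef.
  apply: sep_sub (sce i e f _ _ ef) => //; rewrite ?inE//.
  rewrite expr1 ler_pdivrMr// -ler_pdivrMl// mulrC.
  by rewrite /C1 addrAC lerDr addr_ge0 ?divr_ge0 ?(ltW rho0) ?(ltW C00).
pose T (Q : set X) := exists2 i, i \notin Gd & Q = K i.
pose c' := Num.min c (rho / C3).
have c'0 : 0 < c' by rewrite lt_min c0 divr_gt0.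
have [C4 C40 mT] : exists2 C4, 0 < C4 & forall Q, T Q -> mary C4 0 Q.
  apply: (@mary_of_similar_pieces R X rho M rho01 T C3 c' D) => //.
  move=> _ [i iG ->]; split => //.
  have outE : out i = (bd i :|: gd i)%SET.
    by apply/setP => e; rewrite !inE; case: (_ == _); case: (_ \in _).
  rewrite -[X in parts _ _ _ X]piece_of_out outE piece_ofU.
  rewrite -[X in parts _ _ X _](subnKC (ltnW (fewbad iG))); apply: partsU.
  - rewrite -sum1_card; apply: parts_bigcup_fin.
      move=> e; rewrite inE => /andP[ei eG]; apply: parts1; left.
      by exists (S e), (K (tgt e)); split => //; exists (tgt e).
    move=> e f; rewrite !inE => /andP[ei eG] /andP[fi fG] ef.
    apply: sep_sub (sce i e f _ _ ef) => //; rewrite ?inE//.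
    by rewrite ge_min lexx.
  - apply: sub_parts (pgd i iG) => [B mB|]; first by right.
    by rewrite ge_min lexx orbT.
  - apply: (@sep_sub _ _ c _ (piece_of (bd i)) _ (piece_of (gd i))) => //.
      by rewrite ge_min lexx.
    apply: (sc _ _ i) => //; rewrite finset.disjoints_subset.
    by apply/fintype.subsetP => e; rewrite !inE => /andP[-> ->].
exists (C0 + C4) => [|i]; first exact: addr_gt0.
have [iG|iG] := boolP (i \in Gd).
  by apply: mary_le (mGd iG) => //; rewrite lerDl ltW.
apply: mary_le (mT (K i) _) => //; last by exists i.
by rewrite lerDr ltW.
Qed.

End Transient.

End GraphMary.

(** * Integer eigenvectors and growth of powers *)

(** Bernoulli's inequality [(1 + 1 / a) ^ n >= 1 + n / a] with denominators cleared. *)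
Lemma expn_bernoulli a n : (a ^ n * (a + n) <= a * a.+1 ^ n)%N.
Proof.
elim: n => [|n IH]; first by rewrite !expn0 addn0 mul1n muln1.
have h : (a ^ n <= a.+1 ^ n)%N.
  by case: n {IH} => // n; rewrite leq_exp2r.
rewrite !expnS; move: (a ^ n)%N (a.+1 ^ n)%N h IH => x y h IH.
have : (a * x <= a * y)%N by rewrite leq_mul2l h orbT.
nia.
Qed.

Section PositiveEigenvector.
Variables (p : nat) (G : multidigraph p).

Lemma wsum_edges (w : 'I_p -> nat) i : wsum G w i = (\sum_j #|edges G i j| * w j)%N.
Proof.
rewrite /wsum (partition_big (fun e : edge G => tgt e) predT)//=.
apply: eq_bigr => j _; rewrite (eq_bigr (fun=> w j)) => [|e /andP[_ /eqP<-]//].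
by rewrite sum_nat_const; congr (_ * _)%N; apply: eq_card => e; rewrite !inE.
Qed.

(** The real eigenvector is a combination of rows spanning a rational kernel. Rational coefficients
    close to the real ones keep the equation and, by openness, the positivity. *)
Lemma rat_eigenvector (R : realType) m : integer_characteristic R G m ->
  exists q : 'I_p -> rat, (forall i, 0 < q i) /\
    forall i, \sum_j (#|edges G i j|)%:R * q j = m%:R * q i.
Proof.
move=> [v v0 Av].
pose A : 'M[rat]_p := \matrix_(i, j) (#|edges G i j|)%:R.
pose B := (A - m%:R%:M)^T.
pose N := kermx B.
have AE : map_mx ratr A = adjacency R G.
  by apply/matrixP => i j; rewrite !mxE rmorph_nat.
have /sub_kermxP : v^T *m map_mx ratr B = 0.
  rewrite -map_trmx -trmx_mul map_mxB map_scalar_mx AE rmorph_nat mulmxBl Av.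
  by rewrite mul_scalar_mx subrr trmx0.
rewrite -map_kermx => /submxP[y vy].
have vE i : v i 0 = \sum_k y 0 k * ratr (N k i).
  have := congr1 (fun M : 'rV_p => M 0 i) vy; rewrite !mxE => ->.
  by apply: eq_bigr => k _; rewrite !mxE.
(* Errors below [d] in the coefficients move entry [i] by less than [d * s i]; the summand [1] keeps
   [s i] positive and the estimate strict. *)
pose s i : R := 1 + \sum_k `|ratr (N k i)|.
have s0 i : 0 < s i by rewrite ltr_pwDl// sumr_ge0.
have [d d0 dv] : exists2 d : R, 0 < d & forall i, d * s i <= v i 0.
  apply: (@finite_lower_bound R 'I_p (fun i d => d * s i <= v i 0)) => [i c c' cc|i].
    by apply: le_trans; rewrite ler_pM2r.
  by exists (v i 0 / s i); [rewrite divr_gt0|rewrite divfK// lt0r_neq0].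
have /choice[y' y'P] : forall k, exists q : rat, `|y 0 k - ratr q| < d.
  move=> k; have [|q] := @rat_in_itvoo R (y 0 k - d) (y 0 k + d).
    by rewrite ltrBlDr -addrA ltrDl addr_gt0.
  rewrite in_itv /= => /andP[h1 h2]; exists q.
  by rewrite ltr_distlC; apply/andP; split; lra.
pose q i : rat := \sum_k y' k * N k i.
exists q; split => [i|i].
  rewrite -(ltr_rat R) rmorph0 /q rmorph_sum /=.
  have : `|v i 0 - \sum_k ratr (y' k * N k i)| < v i 0.
    apply: lt_le_trans (dv i).
    rewrite vE -sumrB; apply: le_lt_trans (ler_norm_sum _ _ _) _.
    apply: (@le_lt_trans _ _ (\sum_k d * `|ratr (N k i)|)).
      apply: ler_sum => k _; rewrite rmorphM /= -mulrBl normrM ler_wpM2r// ltW//.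
    by rewrite -mulr_sumr ltr_pM2l// /s ltrDr.
  by rewrite ltr_distlC => /andP[]; rewrite subrr.
pose u : 'rV[rat]_p := \row_k y' k.
have uNB : (u *m N) *m B = 0 by rewrite -mulmxA mulmx_ker mulmx0.
have := congr1 (fun M : 'rV_p => M 0 i) uNB; rewrite mxE [RHS]mxE.
have qE j : (u *m N) 0 j = q j by rewrite mxE; apply: eq_bigr => k _; rewrite mxE.
under eq_bigr do rewrite qE !mxE mulrBr mulrC.
rewrite sumrB => /eqP; rewrite subr_eq0 => /eqP ->.
rewrite (bigD1 i)//= eqxx mulr1n mulrC big1 ?addr0// => j ji.
by rewrite eq_sym (negPf ji) mulr0n mulr0.
Qed.

Lemma nat_eigenvector (R : realType) m : integer_characteristic R G m ->
  exists w : 'I_p -> nat, (forall i, (0 < w i)%N) /\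
    forall i, wsum G w i = (m * w i)%N.
Proof.
move=> /rat_eigenvector[q [q0 qm]].
pose d := \prod_i denq (q i).
have d0 : 0 < d by apply: prodr_gt0 => i _; exact: denq_gt0.
have /choice[w wP] : forall i, exists w : nat, (w%:R : rat) = d%:~R * q i.
  move=> i; exists (absz (numq (q i) * \prod_(j | j != i) denq (q j))).
  have h0 : 0 <= numq (q i) * \prod_(j | j != i) denq (q j).
    apply: mulr_ge0; first by rewrite numq_ge0 ltW.
    by apply: prodr_ge0 => j _; exact: ltW (denq_gt0 _).
  have dE : d = denq (q i) * \prod_(j | j != i) denq (q j) by rewrite /d (bigD1 i).
  rewrite pmulrn gez0_abs// dE !intrM.
  rewrite -[X in _ = _ * X](divq_num_den (q i)).
  rewrite [RHS]mulrC mulrA divfK// intr_eq0.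
  exact: denq_neq0.
exists w; split => i.
  by rewrite -(ltr_nat rat) wP mulr_gt0// ltr0z.
apply/eqP; rewrite -(eqr_nat rat) wsum_edges natr_sum natrM wP mulrCA -qm mulr_sumr.
by apply/eqP; apply: eq_bigr => j _; rewrite natrM wP mulrCA.
Qed.

End PositiveEigenvector.

(** * Recurrent vertices of an idempotent relation *)

Section RecurrentClasses.
Variables (p : nat) (E : {set 'I_p * 'I_p}).
Hypothesis Eid : relc E E = E.
Hypothesis Etot : forall i, exists j, (i, j) \in E.

Definition succs i := [set j | (i, j) \in E]%SET.

Lemma in_succs i j : (j \in succs i) = ((i, j) \in E).
Proof. by rewrite finset.in_set. Qed.

(** Then [succs i] is a terminal class containing [i] in which every ordered pair is related. *)
Definition recurrent := [set i | (i \in succs i) && [forall t in succs i, succs t == succs i]]%SET.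

Lemma recurrentP i : reflect (i \in succs i /\ forall t, t \in succs i -> succs t = succs i)
  (i \in recurrent).
Proof.
rewrite /recurrent finset.in_set; apply: (iffP idP) => [/andP[ii /forall_inP h]|[ii h]].
  by split => // t ti; apply/eqP; exact: h.
by rewrite ii; apply/forall_inP => t ti; rewrite h.
Qed.

Lemma succs_trans i j : j \in succs i -> (succs j \subset succs i)%SET.
Proof.
rewrite inE => ij; apply/fintype.subsetP => k; rewrite !inE => jk.
by rewrite -Eid; apply/relcP; exists j.
Qed.

Lemma recurrent_succs i t : i \in recurrent -> t \in succs i -> t \in recurrent.
Proof.
move=> /recurrentP[ii iE] ti; apply/recurrentP.
by rewrite (iE t ti); split => // s si; rewrite iE.
Qed.

(** A successor [t] of [i] with the fewest successors works up to one step: by transitivity all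
    successors of [t] have the same successors as [t]. Since [t] need not succeed itself, a
    successor [s] of [t] is taken. *)
Lemma recurrent_reachable i : exists2 j, j \in succs i & j \in recurrent.
Proof.
have [j0 j0i] : exists j, j \in succs i by have [j ij] := Etot i; exists j; rewrite inE.
case: (arg_minnP (fun t => #|succs t|) j0i) => t ti tmin.
have tE s : s \in succs t -> succs s = succs t.
  move=> st; apply/eqP; rewrite eqEcard succs_trans//= tmin//.
  exact: (fintype.subsetP (succs_trans ti)).
have [s st] : exists s, s \in succs t by have [s ts] := Etot t; exists s; rewrite inE.
exists s; first exact: (fintype.subsetP (succs_trans ti)).
by apply/recurrentP; rewrite (tE s st); split => // u /tE.
Qed.

Lemma relpow_id n : relpow E n = E.
Proof. by elim: n => [//|n IH] /=; rewrite IH. Qed.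

End RecurrentClasses.

(** * Path counts in large powers *)

Section LargePowers.
Variables (p : nat) (G : multidigraph p) (m : nat) (w : 'I_p -> nat).
Hypotheses (m2 : (2 <= m)%N) (w0 : forall i, (0 < w i)%N).
Hypothesis wm : forall i, wsum G w i = (m * w i)%N.
Hypothesis Eid : relc (reach G) (reach G) = reach G.
Local Notation E := (reach G).
Local Notation V := (\sum_i w i)%N.

Lemma wsum_powSr n (f : 'I_p -> nat) i :
  wsum (pow_graph G n.+1) f i = wsum (pow_graph G n) (wsum G f) i.
Proof.
elim: n i => [|n IH] i; first by rewrite /= wsum_comp.
rewrite [LHS]wsum_comp [RHS]wsum_comp; apply: eq_wsum => j _; exact: IH.
Qed.

Lemma leq_w i : (w i <= V)%N.
Proof. by rewrite (bigD1 i)//= leq_addr. Qed.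

Lemma reach_total i : exists j, (i, j) \in E.
Proof.
apply: contrapT => nij.
have := wm i; rewrite /wsum big_pred0 => [|e].
  by move/esym/eqP; rewrite muln_eq0 eqn0Ngt (ltnW m2)/= eqn0Ngt w0.
by apply/negP => /eqP ei; apply: nij; exists (tgt e); apply/reachP; exists e.
Qed.

Lemma reach_powE n : reach (pow_graph G n) = E.
Proof. by rewrite reach_pow relpow_id. Qed.

(** Every vertex reached from [i] has an edge to [t], so one step applied to the indicator of [t]
    dominates [w / V] there; the eigenvector equation accounts for the other steps. *)
Lemma recurrent_count i n t : i \in recurrent E -> t \in succs E i ->
  (m ^ n.+1 <= V * #|edges (pow_graph G n.+1) i t|)%N.
Proof.
move=> /recurrentP[ii iE] ti.
have -> : #|edges (pow_graph G n.+1) i t| =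
          wsum (pow_graph G n.+1) (fun j => (j == t) : nat) i.
  by rewrite wsum_cond.
rewrite wsum_powSr -wsumZ.
apply: (@leq_trans (wsum (pow_graph G n) w i)).
  by rewrite (wsum_pow _ wm) leq_pmulr.
apply: leq_wsum => j; rewrite reach_powE => ij.
apply: leq_trans (leq_w j) _; rewrite leq_pmulr//.
have jt : (j, t) \in E.
  by rewrite -in_succs iE// in_succs.
by apply: leq_trans (wsum_gt0 _ jt); rewrite eqxx.
Qed.

(** Let [w'] be [w] restricted to transient vertices. At each of them an edge to a recurrent vertex
    loses at least one unit, so a step multiplies [w'] by at most [m - 1 / V], and the count falls
    behind [m ^ n.+1]. *)
Lemma transient_count i n : i \notin recurrent E -> (V * (V * m) <= n)%N ->
  (#|[set e in out (pow_graph G n) i | tgt e \notin recurrent E]%SET| < m ^ n.+1)%N.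
Proof.
move=> iG nV.
have V0 : (0 < V)%N by exact: leq_trans (w0 i) (leq_w i).
pose w' j := (if j \in recurrent E then 0 else w j)%N.
have wV j : (V * wsum G w' j <= (V * m).-1 * w' j)%N.
  rewrite /w'; case: ifPn => jG.
    rewrite muln0 leqn0 muln_eq0; apply/orP; right; apply/eqP.
    apply: big1 => e /eqP ej; rewrite ifT//.
    by apply: (recurrent_succs jG); rewrite in_succs; apply/reachP; exists e.
  have [k] := recurrent_reachable Eid reach_total j; rewrite in_succs => /reachP[e [ej ek]] kG.
  have : (wsum G w' j + 1 <= m * w j)%N.
    rewrite -wm /wsum (bigD1 e) ?ej//= [leqRHS](bigD1 e) ?ej//= /w' ek kG add0n addnC.
    by rewrite leq_add// leq_sum// => f _; case: ifP.
  by have := leq_w j; have := w0 j; rewrite /w'; nia.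
have wVn k j : (V ^ k.+1 * wsum (pow_graph G k) w' j <= (V * m).-1 ^ k.+1 * w' j)%N.
  elim: k j => [|k IH] j; first by rewrite !expn1; exact: wV.
  rewrite [wsum _ _ _]wsum_comp expnSr -mulnA -wsumZ.
  rewrite -wsumZ [X in (_ <= X)%N]mulnC.
  apply: (@leq_trans (wsum G (fun j => V * ((V * m).-1 ^ k.+1 * w' j))%N j)).
    by apply: leq_wsum => l _; rewrite mulnCA leq_mul2l IH orbT.
  rewrite (eq_wsum (w' := fun l => (V * (V * m).-1 ^ k.+1) * w' l)%N); last first.
    by move=> l _; rewrite mulnA.
  rewrite wsumZ mulnC mulnA [(w' j * _)%N]mulnC [X in (_ <= X)%N]mulnC.
  by have := wV j; rewrite [((V * m).-1 ^ k.+2)%N]expnSr; nia.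
have cnt : (#|[set e in out (pow_graph G n) i | tgt e \notin recurrent E]%SET| <=
            wsum (pow_graph G n) w' i)%N.
  have -> : [set e in out (pow_graph G n) i | tgt e \notin recurrent E]%SET =
            [set e | (src e == i) && (tgt e \notin recurrent E)]%SET.
    by apply/setP => e; rewrite !inE.
  rewrite -(wsum_cond _ (fun j => j \notin recurrent E)); apply: leq_wsum => j _.
  by rewrite /w'; case: (j \in recurrent E) => //=; exact: w0.
apply: leq_ltn_trans cnt _.
rewrite -(@ltn_pmul2l (V ^ n.+1)) ?expn_gt0 ?V0//.
apply: leq_ltn_trans (wVn n i) _.
have a0 : (0 < (V * m).-1)%N by nia.
have aS : (V * m)%N = (V * m).-1.+1 by nia.
(* With [a = (V * m).-1], Bernoulli's inequality leaves [a * w' i < a + n.+1], which follows from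
   [V * (V * m) <= n]. *)
rewrite -expnMn -(ltn_pmul2l a0) [in X in (_ < X)%N]aS.
apply: leq_trans (expn_bernoulli _ _).
rewrite mulnCA ltn_pmul2l ?expn_gt0 ?a0//.
have : (w' i <= V)%N by rewrite /w'; case: ifP => // _; exact: leq_w.
nia.
Qed.

End LargePowers.

(** * Even splittings of graph-directed sets *)

Section Assembly.
Variables (R : realType) (X : metricType R) (p : nat) (rho : R) (m : nat).
Variables (K : 'I_p -> set X) (G : multidigraph p) (S : edge G -> X -> X).
Variable w : 'I_p -> nat.
Hypotheses (rho01 : 0 < rho < 1) (m2 : (2 <= m)%N).
Hypotheses (cX : compact [set: X]) (cK : forall i, compact (K i)).
Hypotheses (K0 : forall i, K i !=set0) (sysG : gsystem rho K S).
Hypotheses (w0 : forall i, (0 < w i)%N) (wm : forall i, wsum G w i = (m * w i)%N).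
Hypothesis Eid : relc (reach G) (reach G) = reach G.
Local Notation E := (reach G).
Local Notation V := (\sum_i w i)%N.

(** On the class of [i], the weights divided by their gcd have a Bezout relation of value 1, so
    [packing] provides unit profiles once edges to every vertex of the class are numerous. *)
Lemma recurrent_threshold i : i \in recurrent E -> exists N, forall n, (N <= n)%N ->
  exists2 c, 0 < c & mary (rho ^+ n.+1) (m ^ n.+1) c 0 (K i).
Proof.
move=> iG; have [ii iE] := recurrentP _ _ iG.
have [g [g0 gw [z zg]]] := bezout_family ii (fun t _ => w0 t).
pose u t := (w t %/ g)%N.
have uw t : t \in succs E i -> (w t = g * u t)%N.
  by move=> ti; rewrite mulnC divnK// gw.
have zu : \sum_(t in succs E i) z t * (u t)%:Z = 1.
  have gz : g%:Z != 0 by lia.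
  apply: (mulfI gz); rewrite mulr1 -[RHS]zg mulr_sumr.
  by apply: eq_bigr => t ti; rewrite (uw t ti) PoszM mulrCA.
have [B Bpack] := packing V zu.
(* [recurrent_count] gives [m ^ n.+1 <= V * #|edges|] and [V * B <= n < m ^ n.+1], so there are at
   least [B] edges of each type. *)
exists (V * B).+1 => -[//|n] nB.
have H := gsystem_pow n.+1 (proj1 (andP rho01)) sysG.
have rn : 0 < rho ^+ n.+2 < 1.
  by case/andP: rho01 => ? ?; rewrite exprn_gt0//= exprn_ilt1// ltW.
have mn : (2 <= m ^ n.+2)%N by apply: (leq_trans m2); rewrite -[leqLHS]expn1 leq_exp2l.
have reachH := reach_powE Eid n.+1.
have succH j t : j \in succs E i -> (j, t) \in reach (pow_graph G n.+1) -> t \in succs E i.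
  by move=> ji; rewrite reachH -in_succs iE.
have uH j : j \in succs E i -> wsum (pow_graph G n.+1) u j = (m ^ n.+2 * u j)%N.
  move=> ji; apply/eqP; rewrite -(eqn_pmul2l g0) -wsumZ mulnCA -(uw j ji) -(wsum_pow n.+1 wm).
  apply/eqP; apply: eq_wsum => t jt; rewrite uw//; exact: succH jt.
have [//|||j ji|c c0 mc] := @recurrent_mary R X p _ _ K _ _ rn mn cX cK K0 H (succs E i) u.
- move=> e ei; apply: succH ei _; apply/reachP; by exists e.
- move=> j ji; have := w0 j; rewrite uw// muln_gt0; by case/andP.
- move=> j ji; rewrite mulnC -uH// /wsum; apply: eq_bigl => e; by rewrite inE.
- apply: Bpack.
  + have := w0 j; rewrite uw// muln_gt0 => /andP[_ ->] /=.
    by apply: leq_trans (leq_w w j); rewrite uw// leq_pmull.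
  + move=> t ti; have jG := recurrent_succs iG ji.
    have tj : t \in succs E j by rewrite iE.
    have := recurrent_count w0 wm Eid n jG tj.
    have V0 : (0 < V)%N by exact: leq_trans (w0 i) (leq_w w i).
    move=> h; rewrite -(leq_pmul2l V0); apply: leq_trans h.
    apply: leq_trans (ltnW (ltn_expl n.+1 m2)); lia.
  + rewrite mulnC -uH// wsum_edges [RHS](bigID (mem (succs E i)))/=.
    rewrite [X in (_ + X)%N]big1 ?addn0// => t ti.
    have -> : edges (pow_graph G n.+1) j t = finset.set0.
      apply/setP => e; rewrite !inE; apply: contraNF ti => /andP[/eqP ej /eqP et].
      by apply: (succH j) => //; apply/reachP; exists e.
    by rewrite cards0.
- by exists c => //; exact: mc.
Qed.

Lemma power_mary : exists n, exists2 c, 0 < c &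
  forall i, mary (rho ^+ n.+1) (m ^ n.+1) c 0 (K i).
Proof.
have /choice[N NP] : forall i, exists N, i \in recurrent E -> forall n, (N <= n)%N ->
    exists2 c, 0 < c & mary (rho ^+ n.+1) (m ^ n.+1) c 0 (K i).
  move=> i; have [/recurrent_threshold[N NP]|_] := boolP (i \in recurrent E); last by exists 0%N.
  by exists N.
(* One exponent beyond every recurrent threshold and the bound of [transient_count]. *)
pose n := (\sum_i N i + V * (V * m))%N; exists n.
have rn : 0 < rho ^+ n.+1 < 1.
  by case/andP: rho01 => ? ?; rewrite exprn_gt0//= exprn_ilt1// ltW.
have mn : (2 <= m ^ n.+1)%N by apply: (leq_trans m2); rewrite -[leqLHS]expn1 leq_exp2l.
have [||c c0 mc] := @finite_upper_bound R 'I_p (fun i c => i \in recurrent E ->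
    mary (rho ^+ n.+1) (m ^ n.+1) c 0 (K i)).
- by move=> i c c' c0 cc mi /mi; exact: mary_le.
- move=> i; have [iG|_] := boolP (i \in recurrent E); last by exists 1.
  have [|c c0 mc] := NP i iG n; last by exists c.
  by rewrite /n (bigD1 i)//= -!addnA leq_addr.
have H := gsystem_pow n (proj1 (andP rho01)) sysG.
apply: (transient_mary rn mn cX cK K0 H c0 mc) => i iG.
  by apply: (transient_count m2 w0 wm Eid) => //; rewrite leq_addl.
have [j ij jG] := recurrent_reachable Eid (reach_total m2 w0 wm) i.
have /reachP[e [ei ej]] : (i, j) \in reach (pow_graph G n).
  by rewrite (reach_powE Eid) -in_succs.
by exists e; [rewrite finset.in_set; apply/eqP|rewrite ej].
Qed.

End Assembly.

(** Two powers are taken: the first makes [reach] idempotent, the second makes the splitting even.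
    Their exponents multiply. *)
Lemma frakA_coded (R : realType) (r : R) m (T : metricType R) :
  0 < r < 1 -> (2 <= m)%N -> frakA r m T ->
  exists n, coded (r ^+ n.+1) (m ^ n.+1) T.
Proof.
move=> r01 m2 [X [p [G [S [K [iota [[[cX _] _ sS K0 KS] dS Gm isoi iotaK]]]]]]].
have [r0 r1] := andP r01.
have [w [w0 wm]] := nat_eigenvector Gm.
have cK i : compact (K i) by have [] := K0 i.
have K0' i : K i !=set0 by have [] := K0 i.
have sysG : gsystem r K S.
  split => // [i|e f ef nef].
    rewrite KS; apply/seteqP; split => x.
      by move=> [j _ [e /=]]; rewrite inE => /andP[/eqP ei /eqP <-] Kx; exists e.
    by move=> [e /= ei Kx]; exists (tgt e) => //; exists e => //=; rewrite inE ei !eqxx.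
  apply: contrapT => /eqP/set0P SS; move/eqP: nef; apply.
  by apply: (dS (src f)).
have [a aid] := relpow_idempotent (reach G).
pose H := pow_graph G a.
have Hid : relc (reach H) (reach H) = reach H by rewrite reach_pow.
have sysH := gsystem_pow a r0 sysG.
have ra : 0 < r ^+ a.+1 < 1 by rewrite exprn_gt0//= exprn_ilt1// ltW.
have ma : (2 <= m ^ a.+1)%N by apply: (leq_trans m2); rewrite -[leqLHS]expn1 leq_exp2l.
have [n [c c0 mc]] := power_mary ra ma cX cK K0' sysH w0 (wsum_pow a wm) Hid.
exists (a.+1 * n.+1).-1; rewrite prednK ?muln_gt0// exprM expnM.
apply: (@mary_coded _ X _ _ _ iota c) => //.
- by case/andP: ra => ? ?; rewrite exprn_gt0//= exprn_ilt1// ltW.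
- by apply: (leq_trans ma); rewrite -[leqLHS]expn1 leq_exp2l.
- by rewrite iotaK; exact: mc.
Qed.

(** * Hausdorff dimension of a coded space *)

Lemma sumr_if_lt (V : nmodType) (z : V) k N :
  \sum_(0 <= i < N) (if (i < k)%N then z else 0) = z *+ minn N k.
Proof.
elim: N => [|N IH]; first by rewrite big_nil min0n mulr0n.
rewrite big_nat_recr // IH; case: (leqP k N) => [kN|Nk]; last first.
  by rewrite (minn_idPl Nk) mulrSr.
by rewrite (minn_idPr (leqW kN)); exact: addr0.
Qed.

(** * Kraft sums and words avoiding cylinders *)

Section Kraft.
Variables (R : realType) (m : nat) (a : nat -> nat -> 'I_m) (l : nat -> nat).
Hypothesis m0 : (0 < m)%N.
Local Notation q := (m%:R^-1 : R).

Let q0 : 0 < q. Proof. by rewrite invr_gt0 ltr0n. Qed.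

(* The mass of the part of the [k]-th cylinder lying in the cylinder of the
   first [j] letters of [v]. *)
Let mass k (v : nat -> 'I_m) j : R :=
  if `[< forall i, (i < l k)%N -> (i < j)%N -> a k i = v i >] then q ^+ maxn (l k) j else 0.

Let upd (v : nat -> 'I_m) j c i := if i == j then c else v i.

Let mass_ge0 k v j : 0 <= mass k v j.
Proof. by rewrite /mass; case: ifP => // _; rewrite exprn_ge0// ltW. Qed.

(** From level [l k] on, mass divides equally among the next letters; before it, all mass follows
    the letter [a k j]. *)
Let mass_split k v j : \sum_(c : 'I_m) mass k (upd v j c) j.+1 = mass k v j.
Proof.
have [lj|jl] := leqP (l k) j.
  rewrite (eq_bigr (fun=> mass k v j * q)) => [|c _].
    rewrite sumr_const card_ord -[LHS]mulr_natr mulfVK// pnatr_eq0; lia.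
  have -> : mass k (upd v j c) j.+1 = if `[< forall i, (i < l k)%N -> (i < j)%N -> a k i = v i >]
      then q ^+ maxn (l k) j.+1 else 0.
    rewrite /mass; congr (if _ then _ else _); apply: asbool_equiv_eq; split => h i il ij.
      by have := h i il (ltnW ij); rewrite /upd ltn_eqF.
    have ij' : (i < j)%N by exact: leq_trans lj.
    by rewrite /upd ltn_eqF// h.
  rewrite /mass; case: ifP => _; last by rewrite mul0r.
  by rewrite (maxn_idPr lj) (maxn_idPr (leqW lj)) exprSr.
rewrite (bigD1 (a k j))//= big1 ?addr0 => [|c ca].
  rewrite /mass (maxn_idPl jl) (maxn_idPl (ltnW jl)).
  congr (if _ then _ else _); apply: asbool_equiv_eq; split => h i il ij.
    by have := h i il (ltnW ij); rewrite /upd ltn_eqF.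
  by rewrite /upd; case: eqVneq => [->//|ij']; apply: h => //; lia.
rewrite /mass; case: ifP => // /asboolP/(_ j jl (ltnSn j)).
by rewrite /upd eqxx => /esym/eqP; rewrite (negPf ca).
Qed.

Let total v j := (\sum_(k <oo) (mass k v j)%:E)%E.

Let total_step v j : (total v j < (q ^+ j)%:E)%E ->
  exists c, (total (upd v j c) j.+1 < (q ^+ j.+1)%:E)%E.
Proof.
apply: contraPP => /forallNP h; apply/negP; rewrite -leNgt.
have -> : total v j = (\sum_(c : 'I_m) total (upd v j c) j.+1)%E.
  rewrite /total -nneseries_sum => [|c k _]; last by rewrite lee_fin.
  by apply: eq_eseriesr => k _; rewrite sumEFin mass_split.
apply: (@le_trans _ _ (\sum_(c : 'I_m) (q ^+ j.+1)%:E)%E).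
  rewrite sumEFin lee_fin sumr_const card_ord -[leRHS]mulr_natl exprS mulrA divff ?mul1r//.
  by rewrite pnatr_eq0; lia.
by apply: lee_sum => c _; rewrite leNgt; apply/negP; exact: h.
Qed.

(* The word [u] is built letter by letter: the total mass of the given cylinders
   inside the current one stays below the mass of the current one, since the
   average over the next letter preserves this. *)
Lemma kraft_avoid : (\sum_(k <oo) (q ^+ l k)%:E < 1)%E ->
  exists u : nat -> 'I_m, forall k, exists2 i, (i < l k)%N & a k i <> u i.
Proof.
move=> lt1.
have /choice[nxt nxtP] : forall vj : (nat -> 'I_m) * nat, exists c,
    (total vj.1 vj.2 < (q ^+ vj.2)%:E)%E -> (total (upd vj.1 vj.2 c) vj.2.+1 < (q ^+ vj.2.+1)%:E)%E.
  move=> [v j] /=; have [/total_step[c hc]|nt] := pselect (total v j < (q ^+ j)%:E)%E.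
    by exists c.
  by exists (Ordinal m0).
pose P := fix P j := if j is i.+1 then upd (P i) i (nxt (P i, i)) else fun=> Ordinal m0.
have Pt j : (total (P j) j < (q ^+ j)%:E)%E.
  elim: j => [|j IH]; last exact: (nxtP (P j, j)).
  rewrite expr0; apply: le_lt_trans lt1; apply: lee_nneseries => [k _ _|k _].
    by rewrite lee_fin.
  by rewrite lee_fin /mass maxn0; case: ifP => // _; rewrite exprn_ge0// ltW.
pose u i := P i.+1 i.
have Pu j i : (i < j)%N -> P j i = u i.
  elim: j => // j IH; rewrite ltnS leq_eqVlt => /orP[/eqP->//|ij].
  by rewrite /= /upd ltn_eqF// IH.
exists u => k; apply: contrapT => nex.
have au i : (i < l k)%N -> a k i = u i.
  by move=> il; apply: contrapT => ne; apply: nex; exists i.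
(* If [u] began with the [k]-th word, this cylinder alone would have the full mass of the prefix of
   length [l k]. *)
have := Pt (l k); apply/negP; rewrite -leNgt.
have massk : mass k (P (l k)) (l k) = q ^+ l k.
  rewrite /mass maxnn ifT//; apply/asboolP => i il _.
  by rewrite au// Pu.
rewrite -massk /total.
apply: (@le_trans _ _ (\sum_(k' < k.+1) (mass k' (P (l k)) (l k))%:E)%E).
  rewrite big_ord_recr /= -[leLHS]add0e leeD2r// sume_ge0// => i _.
  by rewrite lee_fin.
rewrite -(big_mkord xpredT (fun k' => (mass k' (P (l k)) (l k))%:E)).
by apply: nneseries_lim_ge => i _; rewrite lee_fin.
Qed.

End Kraft.

Section HausdorffDim.
Variables (R : realType) (r : R) (m : nat) (T : metricType R).
Variables (h : T -> nat -> 'I_m) (C : R).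
Hypotheses (r01 : 0 < r < 1) (m2 : (2 <= m)%N) (C0 : 0 < C).
Hypothesis hs : forall u : nat -> 'I_m, exists x, forall n, h x n = u n.
Hypothesis ha : forall x y n, (forall k, (k < n)%N -> h x k = h y k) -> mdist x y <= C * r ^+ n.
Hypothesis hd : forall x y n, h x n <> h y n -> r ^+ n <= C * mdist x y.
Local Notation s0 := (ln (m%:R : R) / - ln r).

Let r0 : 0 < r. Proof. by case/andP: r01. Qed.
Let r1 : r < 1. Proof. by case/andP: r01. Qed.
Let mR0 : 0 < (m%:R : R). Proof. by rewrite ltr0n; lia. Qed.
Let lnr : 0 < - ln r. Proof. by rewrite oppr_gt0 ln_lt0. Qed.

Lemma powR_lt_inv s : s0 < s -> m%:R * r `^ s < 1.
Proof.
rewrite ltr_pdivrMr// => h1.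
rewrite -ltr_ln ?posrE ?mulr_gt0 ?powR_gt0// ln1 lnM ?posrE ?powR_gt0// ln_powR.
lra.
Qed.

Lemma inv_le_powR s : s < s0 -> m%:R^-1 <= r `^ s.
Proof.
rewrite ltr_pdivlMr// => h1.
rewrite -ler_ln ?posrE ?invr_gt0 ?powR_gt0// lnV// ln_powR.
lra.
Qed.

Lemma diam_ge0 (A : set T) : (0 <= diam A)%E.
Proof. by apply: ereal_sup_ubound; left. Qed.

Lemma diam_le_fin (A : set T) (d : R) : 0 <= d -> diam_le d A -> (diam A <= d%:E)%E.
Proof.
move=> d0 Ad; apply: ge_ereal_sup => _ [->|[[x y] /= [Ax Ay] <-]]; rewrite lee_fin//.
exact: Ad.
Qed.

Lemma mdist_le_diam (A : set T) x y : A x -> A y -> ((mdist x y)%:E <= diam A)%E.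
Proof. by move=> Ax Ay; apply: ereal_sup_ubound; right; exists (x, y). Qed.

Lemma hausdorff_gauge_ge0 s (A : set T) : (0 <= hausdorff_gauge s A)%E.
Proof. by rewrite /hausdorff_gauge; case: ifP => // _; exact: poweR_ge0. Qed.

Lemma hausdorff_gauge_le s (A : set T) (d : R) : 0 <= s -> 0 <= d ->
  diam_le d A -> (hausdorff_gauge s A <= (d `^ s)%:E)%E.
Proof.
move=> s_ge0 d0 Ad; rewrite /hausdorff_gauge; case: ifP => _.
  by rewrite lee_fin powR_ge0.
rewrite -poweR_EFin; apply: gt0_ler_poweR => //.
- by rewrite in_itv /= leey diam_ge0.
- by rewrite in_itv /= leey lee_fin d0.
- exact: diam_le_fin.
Qed.

Lemma hausdorff_premeasure_ge0 s d (A : set T) : (0 <= hausdorff_premeasure s d A)%E.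
Proof.
apply: le_ereal_inf_tmp => _ [U _ <-]; apply: nneseries_ge0 => n _ _.
exact: hausdorff_gauge_ge0.
Qed.

(** The [m ^ n] cylinders of level [n] have gauge sum at most a constant times the [n]-th power of
    [t], and [t < 1] above [s0]. *)
Lemma hausdorff_measure_eq0 s : 0 <= s -> s0 < s -> hausdorff_measure s [set: T] = 0%E.
Proof.
move=> s_ge0 s0s; apply/eqP; rewrite eq_le; apply/andP; split; last first.
  apply: (le_trans (hausdorff_premeasure_ge0 s 1 [set: T])).
  by apply: ereal_sup_ubound; exists 1 => //=.
apply: ge_ereal_sup => _ [d /= d0 <-].
apply/lee_addgt0Pr => e e0; rewrite add0e.
pose t := m%:R * r `^ s.
have t01 : 0 < t < 1 by rewrite powR_lt_inv// mulr_gt0// powR_gt0.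
have Cs0 : 0 < C `^ s by exact: powR_gt0.
have [n1 n1P] := exprn_lt_eps r01 (divr_gt0 d0 C0).
have [n2 n2P] := exprn_lt_eps t01 (divr_gt0 e0 Cs0).
pose n := maxn n1 n2.
have nd : C * r ^+ n <= d.
  rewrite mulrC -ler_pdivlMr//; apply: le_trans (ltW n1P).
  by rewrite ler_wiXn2l ?ltW// leq_maxl.
have ne : C `^ s * t ^+ n <= e.
  rewrite mulrC -ler_pdivlMr//; apply: le_trans (ltW n2P).
  by case/andP: t01 => ? ?; rewrite ler_wiXn2l ?ltW// leq_maxr.
pose W : finType := {ffun 'I_n -> 'I_m}.
have cardW : #|W| = (m ^ n)%N by rewrite card_ffun !card_ord.
(* Cylinder number [k] for [k < m ^ n], the empty set afterwards. *)
pose U (k : nat) : set T := [set x | exists2 i : 'I_#|W|, k = i &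
   forall j : 'I_n, h x j = enum_val i j].
have dU k : diam_le (C * r ^+ n) (U k).
  move=> x y [i ki xi] [i' ki' yi]; apply: ha => j jn.
  have ii' : i = i' by apply: val_inj; rewrite /= -ki -ki'.
  by have := xi (Ordinal jn); have := yi (Ordinal jn); rewrite -ii' /= => -> ->.
have dn0 : 0 <= C * r ^+ n by rewrite mulr_ge0 ?exprn_ge0 ?ltW.
apply: (@le_trans _ _ (\sum_(k <oo) hausdorff_gauge s (U k))%E).
  apply: ereal_inf_lbound; exists U => //; split => [k|x _].
    by apply: diam_le_fin; [exact: ltW|exact: diam_le_sub (dU k)].
  pose f : W := [ffun j : 'I_n => h x j].
  by exists (enum_rank f) => //; exists (enum_rank f) => // j; rewrite enum_rankK ffunE.
apply: lime_le.
  by apply: is_cvg_nneseries => k _ _; exact: hausdorff_gauge_ge0.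
apply: nearW => N.
apply: (@le_trans _ _ (\sum_(0 <= k < N) (if (k < m ^ n)%N then (C * r ^+ n) `^ s else 0)%:E)%E).
  apply: lee_sum => k _; case: ifPn => kmn; first exact: hausdorff_gauge_le.
  rewrite /hausdorff_gauge ifT//; apply/asboolP/seteqP; split => // x [i ki _].
  by move: kmn; rewrite ki -cardW ltn_ord.
rewrite sumEFin lee_fin; apply: le_trans ne.
have -> : C `^ s * t ^+ n = (C * r ^+ n) `^ s *+ (m ^ n).
  have rn : (r ^+ n) `^ s = (r `^ s) ^+ n.
    by rewrite -powR_mulrn ?ltW// powRAC powR_mulrn ?powR_ge0.
  rewrite powRM; [|exact: ltW|by rewrite exprn_ge0// ltW].
  by rewrite rn /t exprMn -[RHS]mulr_natl natrX mulrCA.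
rewrite sumr_if_lt.
by rewrite ler_wpMn2l ?powR_ge0// geq_minr.
Qed.

(** Take the least [l] with [r ^+ l <= C * d]; points differing earlier would be too far apart. A
    set of diameter zero lies in cylinders of all levels, and there the slack [0 < b] determines
    [l]. *)
Lemma diam_cylinder_level (A : set T) (s b : R) (d : R) : 0 <= d -> diam A = d%:E ->
  0 <= s -> m%:R^-1 <= r `^ s -> 0 < b -> C `^ s * d `^ s <= b ->
  exists l, (m%:R^-1 : R) ^+ l <= b /\
    forall x y, A x -> A y -> forall k, (k < l)%N -> h x k = h y k.
Proof.
move=> d0 Ad s_ge0 ms b0 Cdb.
have dA x y : A x -> A y -> mdist x y <= d.
  by move=> Ax Ay; have := mdist_le_diam Ax Ay; rewrite Ad lee_fin.
have m01 : 0 < (m%:R^-1 : R) < 1.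
  by rewrite invr_gt0 mR0 invf_lt1// ltr1n.
have [d_gt0|d_eq0] := ltP 0 d; last first.
  have [l lb] := exprn_lt_eps m01 b0; exists l; split; first exact: ltW.
  move=> x y Ax Ay k _; suff -> : x = y by [].
  apply/eqP; rewrite -[_ == _]negbK -mdist_gt0 -leNgt.
  exact: le_trans (dA _ _ Ax Ay) d_eq0.
have [l0 l0P] := exprn_lt_eps r01 (mulr_gt0 C0 d_gt0).
have ex : exists l, r ^+ l <= C * d by exists l0; exact: ltW.
case: (ex_minnP ex) => l lP lmin; exists l; split.
  apply: le_trans Cdb; rewrite -powRM; [|exact: ltW|exact: ltW].
  apply: (@le_trans _ _ ((r ^+ l) `^ s)).
    rewrite -[r ^+ l]powR_mulrn ?(ltW r0)// powRAC powR_mulrn ?powR_ge0//.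
    by rewrite lerXn2r ?nnegrE ?powR_ge0 ?invr_ge0 ?(ltW mR0).
  by rewrite ge0_ler_powR ?nnegrE ?exprn_ge0 ?mulr_ge0 ?(ltW C0) ?(ltW r0).
move=> x y Ax Ay k kl; apply: contrapT => /hd rk.
have : r ^+ k <= C * d by apply: le_trans rk _; rewrite ler_pM2l// dA.
by move/lmin; rewrite leqNgt kl.
Qed.

(** A cover of small gauge sum would lie in cylinders of Kraft sum below one, and a word avoiding
    them all codes an uncovered point. *)
Lemma hausdorff_measure_neq0 s : 0 <= s -> s < s0 -> hausdorff_measure s [set: T] <> 0%E.
Proof.
move=> s_ge0 ss0 Hs0; have ms := inv_le_powR ss0.
have Cs0 : 0 < C `^ s by exact: powR_gt0.
have : (hausdorff_premeasure s 1 [set: T] < (C `^ s)^-1%:E * (2^-1)%:E)%E.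
  apply: (@le_lt_trans _ _ 0%E); last by rewrite -EFinM lte_fin mulr_gt0// invr_gt0.
  by rewrite -Hs0; apply: ereal_sup_ubound; exists 1 => //=.
move=> /ereal_inf_lt[_ [U [dU TU] <-] sumU].
have /choice[D DP] : forall k, exists d : R, 0 <= d /\ diam (U k) = d%:E.
  move=> k; have := diam_ge0 (U k); have := dU k.
  by case: (diam (U k)) => [d _ d0|//|//]; exists d.
(* The extra terms sum to one half and keep [b k] positive for sets of zero gauge; the main terms
   sum to less than one half by the choice of the cover. *)
pose b k : R := C `^ s * fine (hausdorff_gauge s (U k)) + 2^-1 / (2 ^ k.+1)%:R.
have gfin k : hausdorff_gauge s (U k) = (fine (hausdorff_gauge s (U k)))%:E.
  rewrite /hausdorff_gauge; case: ifP => // _.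
  by have [_ ->] := DP k; rewrite poweR_EFin.
have eps0 k : 0 < 2^-1 / (2 ^ k.+1)%:R :> R by rewrite divr_gt0// ltr0n expn_gt0.
have b0 k : 0 < b k.
  by rewrite ltr_wpDl// mulr_ge0 ?(ltW Cs0)// fine_ge0// hausdorff_gauge_ge0.
have /choice[al alP] : forall k, exists al : (nat -> 'I_m) * nat,
    (m%:R^-1 : R) ^+ al.2 <= b k /\ forall x, U k x -> forall i, (i < al.2)%N -> al.1 i = h x i.
  move=> k; have m0 : (0 < m)%N by lia.
  have m01 : 0 < (m%:R^-1 : R) < 1 by rewrite invr_gt0 mR0 invf_lt1// ltr1n.
  have [Uk0|/eqP/set0P[x Ux]] := pselect (U k = set0).
    have [l lb] := exprn_lt_eps m01 (b0 k).
    exists ((fun=> Ordinal m0), l); split; first exact: ltW.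
    by move=> x /=; rewrite Uk0.
  have [d0 dE] := DP k.
  have [|l [lb lU]] := @diam_cylinder_level (U k) s (b k) (D k) d0 dE s_ge0 ms (b0 k).
    rewrite /b /hausdorff_gauge ifF; last by apply/asboolP => Uk0; rewrite Uk0 in Ux.
    by rewrite dE poweR_EFin /= lerDl ltW.
  by exists (h x, l); split => //= y Uy i il; apply: lU.
have m0 : (0 < m)%N by lia.
have [|u uP] := @kraft_avoid R m (fun k => (al k).1) (fun k => (al k).2) m0.
  apply: (@le_lt_trans _ _ (\sum_(k <oo) ((C `^ s)%:E * hausdorff_gauge s (U k) +
            (2^-1 / (2 ^ k.+1)%:R)%:E))%E).
    apply: lee_nneseries => [k _ _|k _].
      by rewrite lee_fin exprn_ge0// invr_ge0 ltW.
    by rewrite gfin -EFinM -EFinD lee_fin; have [] := alP k.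
  apply: le_lt_trans (epsilon_trick _ _ _) _ => [k||].
  - by rewrite mule_ge0 ?hausdorff_gauge_ge0// lee_fin ltW.
  - by rewrite invr_ge0.
  - rewrite nneseriesZl => [|k _]; last exact: hausdorff_gauge_ge0.
    have : ((C `^ s)%:E * \sum_(k <oo) hausdorff_gauge s (U k) < (2^-1)%:E)%E.
      by rewrite -lte_pdivlMl.
    move=> h1; apply: (@lt_le_trans _ _ ((2^-1)%:E + (2^-1)%:E)%E).
      by rewrite lteD2rE.
    by rewrite -EFinD lee_fin; lra.
have [x xu] := hs u.
have [k _ Ukx] : (\bigcup_n U n) x by exact: TU.
have [i il []] := uP k.
by have [_ /(_ x Ukx i il) ->] := alP k; exact: xu.
Qed.

Lemma hausdorff_dim_code : hausdorff_dim [set: T] = s0%:E.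
Proof.
have s00 : 0 <= s0 by rewrite divr_ge0 ?ln_ge0 ?ler1n// ?ltW//; lia.
apply/eqP; rewrite eq_le; apply/andP; split.
  apply/lee_addgt0Pr => e e0; rewrite -EFinD.
  apply: ereal_inf_lbound; exists (s0 + e) => //=; split; first by rewrite addr_ge0// ltW.
  by apply: hausdorff_measure_eq0; rewrite ?addr_ge0 ?ltrDl// ltW.
apply: le_ereal_inf_tmp => _ [s /= [s_ge0 Hs] <-].
rewrite lee_fin leNgt; apply/negP => ss0.
exact: hausdorff_measure_neq0 s_ge0 ss0 Hs.
Qed.

End HausdorffDim.

Lemma coded_dim (R : realType) (r : R) m (T : metricType R) : 0 < r < 1 -> (2 <= m)%N ->
  coded r m T -> hausdorff_dim [set: T] = (ln m%:R / - ln r)%:E.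
Proof.
move=> r01 m2 [h [C [C0 hs ha hd]]].
exact: (@hausdorff_dim_code R r m T h C).
Qed.

(** * Two codings of the same space *)

Lemma sum_nat_divn (f : nat -> nat) n k : (0 < k)%N ->
  (\sum_(0 <= i < n * k) f (i %/ k) = k * \sum_(0 <= i < n) f i)%N.
Proof.
move=> k0; elim: n => [|n IH]; first by rewrite mul0n !big_nil muln0.
rewrite big_nat_recr//= mulnDr -IH mulSn addnC.
rewrite (big_cat_nat _ (n := n * k)%N) ?leq_addr//=; congr (_ + _)%N.
rewrite -{1}[(n * k)%N]add0n big_addn addKn.
rewrite (eq_big_nat _ _ (F2 := fun=> f n)) => [|i /andP[_ ik]].
  by rewrite sum_nat_const_nat subn0 mulnC.
by rewrite divnDMl// divn_small.
Qed.

Section Rigidity.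
Variables (R : realType) (T : Type) (d : T -> T -> R).
Variables (r1 r2 : R) (m1 m2 : nat) (h1 : T -> nat -> 'I_m1) (h2 : T -> nat -> 'I_m2).
Variables (C1 C2 : R).
Hypotheses (r101 : 0 < r1 < 1) (r201 : 0 < r2 < 1) (m1_gt1 : (2 <= m1)%N) (m2_gt1 : (2 <= m2)%N).
Hypotheses (C10 : 0 < C1) (C20 : 0 < C2).
Hypothesis hs1 : forall u : nat -> 'I_m1, exists x, forall n, h1 x n = u n.
Hypothesis hs2 : forall u : nat -> 'I_m2, exists x, forall n, h2 x n = u n.
Hypothesis ha1 : forall x y n, (forall k, (k < n)%N -> h1 x k = h1 y k) -> d x y <= C1 * r1 ^+ n.
Hypothesis ha2 : forall x y n, (forall k, (k < n)%N -> h2 x k = h2 y k) -> d x y <= C2 * r2 ^+ n.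
Hypothesis hd1 : forall x y n, h1 x n <> h1 y n -> r1 ^+ n <= C1 * d x y.
Hypothesis hd2 : forall x y n, h2 x n <> h2 y n -> r2 ^+ n <= C2 * d x y.

Let r10 : 0 < r1. Proof. by case/andP: r101. Qed.
Let r20 : 0 < r2. Proof. by case/andP: r201. Qed.
Let r1_le j k : (j <= k)%N -> r1 ^+ k <= r1 ^+ j.
Proof. by case/andP: r101 => ? ? jk; rewrite ler_wiXn2l ?ltW. Qed.
Let r2_le j k : (j <= k)%N -> r2 ^+ k <= r2 ^+ j.
Proof. by case/andP: r201 => ? ? jk; rewrite ler_wiXn2l ?ltW. Qed.
Let D := C1 * C2.
Let D0 : 0 < D. Proof. exact: mulr_gt0. Qed.
Let m10 : (0 < m1)%N. Proof. exact: ltnW. Qed.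
Let m20 : (0 < m2)%N. Proof. exact: ltnW. Qed.

Definition agree1 k x y := forall j, (j < k)%N -> h1 x j = h1 y j.

Let ex_level k : exists l, D * r2 ^+ l < r1 ^+ k.
Proof.
have [l lP] := exprn_lt_eps r201 (divr_gt0 (exprn_gt0 k r10) D0).
by exists l; rewrite mulrC -ltr_pdivlMr.
Qed.

(* Cylinders of level [level k] for [h2] are contained in cylinders of level
   [k] for [h1], and have comparable diameter. *)
Let level k := ex_minn (ex_level k).

Let level_lt k : D * r2 ^+ level k < r1 ^+ k.
Proof. by rewrite /level; case: ex_minnP. Qed.

Let level_min k l : (l < level k)%N -> r1 ^+ k <= D * r2 ^+ l.
Proof.
rewrite /level; case: ex_minnP => n _ nmin ln; rewrite leNgt; apply/negP => /nmin.
by rewrite leqNgt ln.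
Qed.

Let level_mono k n : (level k <= level (k + n))%N.
Proof.
rewrite leqNgt; apply/negP => /level_min; apply/negP; rewrite -ltNge.
apply: lt_le_trans (level_lt _) _.
by apply: r1_le; rewrite leq_addr.
Qed.

(** The first [L] letters in base [m2]: cylinders become integers below [m2 ^ L], and prefixes
    become quotients. *)
Fixpoint code y L : nat := if L is l.+1 then (code y l * m2 + h2 y l)%N else 0%N.

Let code_lt y L : (code y L < m2 ^ L)%N.
Proof.
elim: L => [//|L IH] /=; rewrite expnSr.
by have := ltn_ord (h2 y L); nia.
Qed.

Let code_div y L : (code y L.+1 %/ m2 = code y L)%N.
Proof. by rewrite /= divnMDl// divn_small ?addn0. Qed.

Let code_agree x y L : code x L = code y L <-> (forall k, (k < L)%N -> h2 x k = h2 y k).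
Proof.
split; elim: L => [//|L IH] /=.
  move=> cxy k; rewrite ltnS leq_eqVlt => /orP[/eqP->|kL].
    apply: val_inj; have := congr1 (modn^~ m2) cxy => /=.
    by rewrite !modnMDl !modn_small.
  apply: IH kL; have := congr1 (divn^~ m2) cxy => /=.
  by rewrite !divnMDl// !divn_small// !addn0.
by move=> h; rewrite IH ?h// => k kL; apply: h; exact: ltnW.
Qed.

(** A difference at [j < k] would force [r1 ^+ k <= C1 * d x y <= D * r2 ^+ level k], against the
    choice of [level]. *)
Let code_refine k L x y : (level k <= L)%N -> code x L = code y L -> agree1 k x y.
Proof.
move=> kL /code_agree/ha2 dxy j jk; apply: contrapT => /hd1 jd.
suff : D * r2 ^+ level k < D * r2 ^+ level k by rewrite ltxx.
apply: (lt_le_trans (level_lt k)).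
apply: (@le_trans _ _ (r1 ^+ j)).
  exact: r1_le (ltnW jk).
apply: (le_trans jd); rewrite /D -mulrA ler_pM2l//.
by apply: (le_trans dxy); rewrite ler_pM2l// r2_le.
Qed.

Let code_extend y L (c : nat) : (c < m2)%N ->
  exists y', code y' L.+1 = (code y L * m2 + c)%N.
Proof.
move=> cm; have [y' y'P] := hs2 (fun i => if i == L then Ordinal cm else h2 y i).
exists y'; rewrite /= y'P eqxx /=; congr (_ * _ + _)%N.
by apply/code_agree => k kL; rewrite y'P ltn_eqF.
Qed.

Let hits x k L n : bool := `[< exists2 y, code y L = n & agree1 k x y >].

(** For [level k <= L], a cylinder of the second coding that is hit is contained in the cylinder of
    [x]. *)
Definition cnt x k L := (\sum_(0 <= n < m2 ^ L) hits x k L n)%N.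

Let cntS x k L : (level k <= L)%N -> cnt x k L.+1 = (m2 * cnt x k L)%N.
Proof.
move=> kL; rewrite /cnt expnSr -sum_nat_divn//; apply: eq_big_nat => n _.
congr nat_of_bool; apply: asbool_equiv_eq; split => -[y yn xy].
  by exists y => //; rewrite -yn code_div.
have [y' y'n] := code_extend y L (ltn_pmod n m20).
exists y'; first by rewrite y'n yn -divn_eq.
have yy' : agree1 k y y'.
  by apply: (code_refine kL); rewrite -[RHS]code_div y'n divnMDl// divn_small ?addn0// ltn_pmod.
by move=> j jk; rewrite xy// yy'.
Qed.

Let cntD x k e : cnt x k (level k + e) = (m2 ^ e * cnt x k (level k))%N.
Proof.
elim: e => [|e IH]; first by rewrite addn0 mul1n.
by rewrite addnS cntS ?leq_addr// IH mulnA -expnS.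
Qed.

Let cnt0 x L : cnt x 0 L = (m2 ^ L)%N.
Proof.
rewrite /cnt (eq_big_nat _ _ (F2 := fun=> 1%N)) => [|n /andP[_ nL]].
  by rewrite sum_nat_const_nat subn0 muln1.
rewrite /hits asboolT//; elim: L n nL => [|L IH] n nL.
  by exists x => //; move: nL; rewrite expn0 ltnS leqn0 => /eqP.
have [|y yn _] := IH (n %/ m2)%N; first by rewrite ltn_divLR// -expnSr.
have [y' y'n] := code_extend y L (ltn_pmod n m20).
by exists y' => //; rewrite y'n yn -divn_eq.
Qed.

Let child_ex x k (c : 'I_m1) : exists y, agree1 k x y /\ h1 y k = c.
Proof.
have [y yP] := hs1 (fun i => if i == k then c else h1 x i).
by exists y; split => [j jk|]; rewrite yP ?eqxx// ltn_eqF.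
Qed.

Let cnt_children x k L (y : 'I_m1 -> T) : (level k.+1 <= L)%N ->
  (forall c, agree1 k x (y c) /\ h1 (y c) k = c) ->
  cnt x k L = (\sum_c cnt (y c) k.+1 L)%N.
Proof.
move=> kL yP; rewrite /cnt exchange_big /=; apply: eq_big_nat => n _.
have agS c z : agree1 k.+1 (y c) z <-> agree1 k x z /\ h1 z k = c.
  have [xy yk] := yP c; split => [yz|[xz zk] j].
    by split=> [j jk|]; [rewrite xy// yz// ltnW|rewrite -yz// yk].
  by rewrite ltnS leq_eqVlt => /orP[/eqP->|jk]; [rewrite yk zk|rewrite -xy// xz].
have [[z zn xz]|nh] := pselect (exists2 z, code z L = n & agree1 k x z).
  rewrite /hits asboolT; last by exists z.
  rewrite (bigD1 (h1 z k))//= asboolT; last by exists z => //; apply/agS.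
  rewrite big1 ?addn0// => c ck; rewrite asboolF// => -[z' z'n /agS[xz' z'k]].
  move/eqP: ck; apply; rewrite -z'k.
  by apply: (code_refine kL _ (ltnSn k)); rewrite zn.
rewrite /hits asboolF// big1// => c _; rewrite asboolF// => -[z zn /agS[xz _]].
by apply: nh; exists z.
Qed.

(** The [m1] children share the count of the parent, so some child gets at least the average. *)
Let cnt_step_ge x k L : (level k.+1 <= L)%N ->
  exists2 y, agree1 k x y & (cnt x k L <= m1 * cnt y k.+1 L)%N.
Proof.
move=> kL; have [y yP] := choice (child_ex x k).
apply: contrapT => nex.
have : (\sum_c m1 * cnt (y c) k.+1 L < \sum_(c < m1) cnt x k L)%N.
  rewrite (bigD1 (Ordinal m10))//= [ltnRHS](bigD1 (Ordinal m10))//=.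
  have lt c : (m1 * cnt (y c) k.+1 L < cnt x k L)%N.
    by rewrite ltnNge; apply/negP => h; apply: nex; exists (y c) => //; have [] := yP c.
  by rewrite -addSn leq_add// leq_sum// => c _; exact: ltnW.
by rewrite -big_distrr /= -(cnt_children kL yP) sum_nat_const card_ord ltnn.
Qed.

Let cnt_step_le x k L : (level k.+1 <= L)%N ->
  exists2 y, agree1 k x y & (m1 * cnt y k.+1 L <= cnt x k L)%N.
Proof.
move=> kL; have [y yP] := choice (child_ex x k).
apply: contrapT => nex.
have : (\sum_(c < m1) cnt x k L < \sum_c m1 * cnt (y c) k.+1 L)%N.
  rewrite (bigD1 (Ordinal m10))//= [ltnRHS](bigD1 (Ordinal m10))//=.
  have lt c : (cnt x k L < m1 * cnt (y c) k.+1 L)%N.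
    by rewrite ltnNge; apply/negP => h; apply: nex; exists (y c) => //; have [] := yP c.
  by rewrite -addSn leq_add// leq_sum// => c _; exact: ltnW.
by rewrite -big_distrr /= -(cnt_children kL yP) sum_nat_const card_ord ltnn.
Qed.

Let agree1_trans k l x y z : (k <= l)%N -> agree1 k x y -> agree1 l y z -> agree1 k x z.
Proof. by move=> kl xy yz j jk; rewrite xy// yz// (leq_trans jk). Qed.

Let cnt_ge x k n L : (level (k + n) <= L)%N ->
  exists2 y, agree1 k x y & (cnt x k L <= m1 ^ n * cnt y (k + n) L)%N.
Proof.
elim: n L => [|n IH] L kL.
  by exists x => //; rewrite addn0 mul1n.
have [|y xy cy] := IH L; first by apply: leq_trans kL; rewrite addnS -addn1 level_mono.
have [|z yz cz] := @cnt_step_ge y (k + n)%N L; first by rewrite -addnS.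
exists z; first by apply: agree1_trans xy yz; rewrite leq_addr.
by rewrite addnS expnSr -mulnA; apply: leq_trans cy _; rewrite leq_mul2l cz orbT.
Qed.

Let cnt_le x k n L : (level (k + n) <= L)%N ->
  exists2 y, agree1 k x y & (m1 ^ n * cnt y (k + n) L <= cnt x k L)%N.
Proof.
elim: n L => [|n IH] L kL.
  by exists x => //; rewrite addn0 mul1n.
have [|y xy cy] := IH L; first by apply: leq_trans kL; rewrite addnS -addn1 level_mono.
have [|z yz cz] := @cnt_step_le y (k + n)%N L; first by rewrite -addnS.
exists z; first by apply: agree1_trans xy yz; rewrite leq_addr.
by rewrite addnS expnSr -mulnA; apply: leq_trans cy; rewrite leq_mul2l cz orbT.
Qed.

Let cnt_gt0 x k L : (0 < cnt x k L)%N.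
Proof.
rewrite /cnt (bigD1_seq (code x L)) ?iota_uniq//=; last by rewrite mem_index_iota code_lt.
by rewrite /hits asboolT//; exists x.
Qed.

Let code_div_exp y L s : (s <= L)%N -> (code y L %/ m2 ^ s = code y (L - s))%N.
Proof.
elim: s L => [|s IH] L sL; first by rewrite expn0 divn1 subn0.
case: L sL => // L sL.
by rewrite expnS divnMA code_div IH.
Qed.

(** Points of one cylinder of level [k] for [h1] are within a constant times [r2 ^+ level k] of each
    other. Hence their first [level k] letters for [h2] agree except for at most the last [s],
    uniformly in [k]. *)
Let ex_shift : exists s, forall x k, (cnt x k (level k) <= m2 ^ s)%N.
Proof.
have [s sP] := exprn_lt_eps r201 (divr_gt0 ltr01 (mulr_gt0 D0 D0)).
exists s => x k; have [sL|Ls] := leqP s (level k); last first.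
  apply: leq_trans (leq_pexp2l m20 (ltnW Ls)).
  rewrite /cnt -[leqRHS]subn0 -[leqRHS]muln1 -sum_nat_const_nat.
  by apply: leq_sum => n _; case: (hits _ _ _ _).
pose q := code x (level k - s).
have hq n : hits x k (level k) n -> (n %/ m2 ^ s)%N = q.
  move=> /asboolP[y <- xy]; rewrite code_div_exp//; apply/code_agree => i ik.
  apply: contrapT => /hd2 ri.
  have lk : (i + s < level k)%N by lia.
  have h1' := level_min lk.
  have h2' : r2 ^+ i <= D * r1 ^+ k.
    apply: (le_trans ri); rewrite /D [C1 * C2]mulrC -mulrA ler_pM2l//.
    by apply: ha1 => j jk; rewrite xy.
  have h3' : r2 ^+ i <= D * (D * r2 ^+ (i + s)).
    by apply: (le_trans h2'); rewrite ler_pM2l.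
  have h5 : 1 <= D * D * r2 ^+ s.
    rewrite -(ler_pM2r (exprn_gt0 i r20)) mul1r; apply: (le_trans h3').
    by rewrite exprD le_eqVlt; apply/orP; left; apply/eqP; ring.
  have h4 : D * D * r2 ^+ s < 1 by rewrite mulrC -ltr_pdivlMr ?mulr_gt0.
  by move: h5; rewrite leNgt h4.
apply: (@leq_trans (\sum_(0 <= n < m2 ^ level k) ((n %/ m2 ^ s)%N == q))%N).
  rewrite /cnt; apply: leq_sum => n _; case: (boolP (hits _ _ _ _)) => //.
  by move=> /hq ->; rewrite eqxx.
rewrite -(subnK sL) expnD (sum_nat_divn (fun i => i == q : nat)) ?expn_gt0 ?m20//.
rewrite -[leqRHS]muln1 leq_mul2l; apply/orP; right.
have [qm|qm] := ltnP q (m2 ^ (level k - s)).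
  rewrite (bigD1_seq q) ?iota_uniq ?mem_index_iota//= eqxx big1 ?addn0// => i.
  by move/negPf => ->.
rewrite big_nat_cond big1// => i /andP[/andP[_ im] _].
by rewrite ltn_eqF// (leq_trans im).
Qed.

Lemma code_multiplicatively_dependent : exists k1 k2,
  [/\ (1 <= k1)%N, (1 <= k2)%N & (m1 ^ k1 = m2 ^ k2)%N].
Proof.
have [s cntN] := ex_shift; pose N := (m2 ^ s)%N.
have N0 : (0 < N)%N by rewrite expn_gt0 m20.
have [x0 _] := hs1 (fun=> Ordinal m10).
have level_ge k : (m1 ^ k <= m2 ^ level k)%N.
  have [y _] := @cnt_le x0 0 k (level k) (leqnn _); rewrite cnt0; apply: leq_trans.
  by rewrite leq_pmulr.
have level_le k : (m2 ^ level k <= N * m1 ^ k)%N.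
  have [y _] := @cnt_ge x0 0 k (level k) (leqnn _); rewrite cnt0 => /leq_trans; apply.
  by rewrite mulnC leq_mul2r cntN orbT.
pose Q := (N * (N * m1 ^ N))%N.
have Q0 : (0 < Q)%N by rewrite !muln_gt0 N0 expn_gt0 m10.
have cntQ x k n : (n <= N)%N -> (cnt x k (level (k + n)) <= Q)%N.
  move=> nN; rewrite -(subnKC (level_mono k n)) cntD mulnC leq_mul//.
  rewrite -(@leq_pmul2l (m2 ^ level k)) ?expn_gt0 ?m20// -expnD subnKC ?level_mono//.
  apply: leq_trans (level_le _) _; rewrite expnD mulnCA leq_mul ?level_ge//.
  by rewrite leq_mul2l leq_pexp2l ?orbT.
(* No descendant within [N] generations has a larger density, both counts being taken at the same
   level. *)
pose good x k := forall n y, (n <= N)%N -> agree1 k x y ->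
  (m1 ^ n * cnt y (k + n) (level (k + n)) <= cnt x k (level (k + n)))%N.
have [x [k gxk]] : exists x k, good x k.
  apply: contrapT => nogood.
  (* Otherwise the density can be multiplied by [1 + Q^-1] again and again. *)
  have grow j : exists x k, (Q.+1 ^ j * m2 ^ level k <= Q ^ j * (cnt x k (level k) * m1 ^ k))%N.
    elim: j => [|j [x [k IH]]]; first by exists x0, 0%N; rewrite cnt0 expn0 muln1.
    have [n [y [nN xy lt]]] : exists n y, [/\ (n <= N)%N, agree1 k x y &
        (cnt x k (level (k + n)) < m1 ^ n * cnt y (k + n) (level (k + n)))%N].
      apply: contrapT => nex; apply: nogood; exists x, k => n y nN xy.
      by rewrite leqNgt; apply/negP => lt; apply: nex; exists n, y.
    exists y, (k + n)%N; have := cntQ x k n nN.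
    move: lt; set c' := cnt y _ _; rewrite -(subnKC (level_mono k n)) cntD !expnD.
    move: IH; rewrite !expnS.
    set a := (Q.+1 ^ j)%N; set b := (Q ^ j)%N; set e := (m2 ^ (_ - _))%N.
    set c := cnt x k _; set f := (m2 ^ level k)%N; set g := (m1 ^ k)%N; set g' := (m1 ^ n)%N.
    move=> IH lt cQ.
    (* Integers [e * c < g' * c'] with [e * c <= Q] differ by a factor of at least [1 + Q^-1]. *)
    have h : (Q.+1 * (e * c) <= Q * (g' * c'))%N.
      have : (Q * (e * c).+1 <= Q * (g' * c'))%N by rewrite leq_mul2l lt orbT.
      by apply: leq_trans; rewrite mulSn mulnS leq_add2r.
    have -> : (Q.+1 * a * (f * e) = Q.+1 * e * (a * f))%N by ring.
    have -> : (Q * b * (c' * (g * g')) = b * g * (Q * (g' * c')))%N by ring.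
    apply: (@leq_trans (Q.+1 * e * (b * (c * g)))%N); first by rewrite leq_mul2l IH orbT.
    have -> : (Q.+1 * e * (b * (c * g)) = b * g * (Q.+1 * (e * c)))%N by ring.
    by rewrite leq_mul2l h orbT.
  have bound j : (Q.+1 ^ j <= Q ^ j * N)%N.
    have [x [k h]] := grow j.
    have f0 : (0 < m2 ^ level k)%N by rewrite expn_gt0 m20.
    rewrite -(leq_pmul2r f0); apply: leq_trans h _.
    by rewrite -mulnA leq_mul2l leq_mul ?orbT ?level_ge.
  (* The density is at most [N], but at this exponent the power of [1 + Q^-1] exceeds [N]. *)
  have := expn_bernoulli Q (Q * N).+1; have := bound (Q * N).+1.
  have e0 : (0 < Q ^ (Q * N).+1)%N by rewrite expn_gt0 Q0.
  move: (Q ^ _)%N (Q.+1 ^ _)%N e0 => a b a0 ba ab.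
  have : (a * (Q + (Q * N).+1) <= a * (Q * N))%N.
    by apply: leq_trans ab _; rewrite mulnCA leq_mul2l ba orbT.
  by rewrite leq_pmul2l// addnS ltnNge leq_addl.
(* Averaging gives a descendant at least as dense as [x], goodness the converse. These are [N.+1]
   equalities with counts [c] taking at most [N] values. *)
have eqn (n : 'I_N.+1) : exists c : nat, [/\ (0 < c)%N, (c <= N)%N &
    (m1 ^ n * c = m2 ^ (level (k + n) - level k) * cnt x k (level k))%N].
  have nN : (n <= N)%N by rewrite -ltnS.
  have [y xy cy] := @cnt_ge x k n _ (leqnn _).
  exists (cnt y (k + n) (level (k + n))); split; [exact: cnt_gt0|exact: cntN|].
  rewrite -cntD subnKC ?level_mono//; apply/eqP; rewrite eqn_leq cy andbT.
  exact: gxk.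
have [c cP] := choice eqn.
have cord n : ((c n).-1 < N)%N by have [c0 cN _] := cP n; rewrite prednK.
pose f n : 'I_N := Ordinal (cord n).
have /injectivePn[a [b ab fab]] : ~~ injectiveb f.
  by apply/negP => /injectiveP/leq_card; rewrite !card_ord ltnn.
wlog lab : a b ab fab / (a < b)%N.
  move=> th; case: (ltngtP a b) => [|ba|/ord_inj/eqP]; [exact: th| |by rewrite (negPf ab)].
  by apply: (th b a) => //; rewrite eq_sym.
have [ca0 caN ea] := cP a; have [cb0 cbN eb] := cP b.
have cab : c b = c a.
  by have := congr1 (@nat_of_ord N) fab => /= h; rewrite -(prednK cb0) -(prednK ca0) h.
have lev : (level (k + a) <= level (k + b))%N.
  by rewrite -(subnKC (ltnW lab)) addnA level_mono.
have lka := level_mono k a.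
have key : (m1 ^ (b - a) = m2 ^ (level (k + b) - level (k + a)))%N.
  have p0 : (0 < m1 ^ a * c a)%N by rewrite muln_gt0 expn_gt0 m10.
  apply/eqP; rewrite -(eqn_pmul2r p0) mulnA -expnD subnK ?(ltnW lab)// -cab eb cab ea.
  by rewrite mulnA -expnD; apply/eqP; congr (_ ^ _ * _)%N; lia.
exists (b - a)%N, (level (k + b) - level (k + a))%N; split => //; first by rewrite subn_gt0.
rewrite lt0n; apply/negP => /eqP l0; have := ltn_expl (b - a) m1_gt1.
by rewrite key l0 expn0 ltnS leqn0 subn_eq0 leqNgt lab.
Qed.

End Rigidity.

(** * Conclusions for the classes [frakA] *)

Lemma coded_dependent (R : realType) (T : metricType R) (r1 r2 : R) m1 m2 :
  0 < r1 < 1 -> 0 < r2 < 1 -> (2 <= m1)%N -> (2 <= m2)%N ->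
  coded r1 m1 T -> coded r2 m2 T ->
  exists k1 k2, [/\ (1 <= k1)%N, (1 <= k2)%N & (m1 ^ k1 = m2 ^ k2)%N].
Proof.
move=> r101 r201 m12 m22 [h1 [C1 [C10 hs1 ha1 hd1]]] [h2 [C2 [C20 hs2 ha2 hd2]]].
exact: (code_multiplicatively_dependent r101 r201 m12 m22 C10 C20 hs1 hs2 ha1 ha2 hd1 hd2).
Qed.

Lemma frakA_dim (R : realType) (r : R) m (T : metricType R) :
  0 < r < 1 -> (2 <= m)%N -> frakA r m T ->
  hausdorff_dim [set: T] = (ln m%:R / - ln r)%:E.
Proof.
move=> r01 m2 Tr; have [r0 r1] := andP r01.
have [n Tn] := frakA_coded r01 m2 Tr.
have rn : 0 < r ^+ n.+1 < 1 by rewrite exprn_gt0//= exprn_ilt1// ltW.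
have mn : (2 <= m ^ n.+1)%N by apply: (leq_trans m2); rewrite -[leqLHS]expn1 leq_exp2l.
have m0 : 0 < (m%:R : R) by rewrite ltr0n; apply: ltn_trans m2.
rewrite (coded_dim rn mn Tn) natrX !lnXn//; congr EFin.
by rewrite -[ln m%:R *+ _]mulr_natl -[ln r *+ _]mulr_natl -mulrN -mulf_div divff ?mul1r.
Qed.

Lemma coded_pow_bilipschitz (R : realType) (T T' : metricType R) (r r' : R) m m' L L' :
  0 < r < 1 -> 0 < r' < 1 -> (0 < L)%N -> (0 < L')%N ->
  coded r m T -> coded r' m' T' -> r ^+ L = r' ^+ L' -> (m ^ L = m' ^ L')%N ->
  bilipschitz_equivalent T T'.
Proof.
move=> r01 r'01 L0 L'0 /(coded_pow r01 L0) cT /(coded_pow r'01 L'0) + rE mE.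
rewrite -rE -mE => cT'; apply: coded_bilipschitz cT cT'.
by case/andP: r01 => ? ?; rewrite exprn_gt0//= exprn_ilt1 -?lt0n// ltW.
Qed.

Theorem theorem2 (R : realType) :
  (forall (r : R) (m m' : nat) (K K' : metricType R),
     0 < r < 1 -> (2 <= m)%N -> (2 <= m')%N ->
     frakA r m K -> frakA r m' K' ->
     (bilipschitz_equivalent K K' <->
        hausdorff_dim [set: K] = hausdorff_dim [set: K']) /\
     (hausdorff_dim [set: K] = hausdorff_dim [set: K'] <-> m = m')) /\
  (forall (r1 r2 : R) (m1 m2 : nat) (K K' : metricType R),
     0 < r1 < 1 -> 0 < r2 < 1 -> (2 <= m1)%N -> (2 <= m2)%N ->
     frakA r1 m1 K -> frakA r2 m2 K' ->
     (bilipschitz_equivalent K K' <->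
        exists k1 k2 : nat,
          [/\ (1 <= k1)%N, (1 <= k2)%N,
              r1 ^+ k1 = r2 ^+ k2 & (m1 ^ k1)%N = (m2 ^ k2)%N])).
Proof.
have pow01 (r : R) n : 0 < r < 1 -> 0 < r ^+ n.+1 < 1.
  by case/andP => ? ?; rewrite exprn_gt0//= exprn_ilt1// ltW.
have pow2 m n : (2 <= m)%N -> (2 <= m ^ n.+1)%N.
  by move=> m2; apply: (leq_trans m2); rewrite -[leqLHS]expn1 leq_exp2l.
have nat0 m : (2 <= m)%N -> 0 < (m%:R : R) by move=> m2; rewrite ltr0n; apply: ltn_trans m2.
have ln0 (r : R) : 0 < r < 1 -> 0 < - ln r by move=> ?; rewrite oppr_gt0 ln_lt0.
(* Equivalent spaces share a coding, and the coding determines the dimension. *)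
have dim_eq (r1 r2 : R) m1 m2 (K K' : metricType R) :
    0 < r1 < 1 -> 0 < r2 < 1 -> (2 <= m1)%N -> (2 <= m2)%N ->
    frakA r1 m1 K -> frakA r2 m2 K' -> bilipschitz_equivalent K K' ->
    hausdorff_dim [set: K] = hausdorff_dim [set: K'].
  move=> r101 r201 m12 m22 KA K'A KK'.
  have [n Kn] := frakA_coded r101 m12 KA.
  rewrite (coded_dim (pow01 _ n r101) (pow2 _ n m12) Kn).
  by rewrite (coded_dim (pow01 _ n r101) (pow2 _ n m12) (bilipschitz_coded KK' Kn)).
split=> [r m m' K K' r01 m2 m'2 KA K'A|r1 r2 m1 m2 K K' r101 r201 m12 m22 KA K'A].
  have dimE : hausdorff_dim [set: K] = hausdorff_dim [set: K'] <-> m = m'.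
    rewrite (frakA_dim r01 m2 KA) (frakA_dim r01 m'2 K'A); split => [[]|-> //].
    have l0 : - ln r != 0 by rewrite lt0r_neq0// ln0.
    move=> /(divIf l0)/ln_inj; rewrite !posrE => /(_ (nat0 _ m2) (nat0 _ m'2)) /eqP.
    by rewrite eqr_nat => /eqP.
  split => //; split; first exact: (dim_eq r r m m').
  move=> /dimE mm'; subst m'.
  have [n Kn] := frakA_coded r01 m2 KA; have [n' K'n] := frakA_coded r01 m2 K'A.
  (* Raising each normal form to the exponent of the other makes the parameters agree. *)
  apply: (coded_pow_bilipschitz (pow01 _ n r01) (pow01 _ n' r01) (ltn0Sn n') (ltn0Sn n) Kn K'n).
    by rewrite -!exprM mulnC.
  by rewrite -!expnM mulnC.
have [n Kn] := frakA_coded r101 m12 KA; have [n' K'n] := frakA_coded r201 m22 K'A.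
split => [KK'|[k1 [k2 [k10 k20 rE mE]]]]; last first.
  apply: (coded_pow_bilipschitz (L := n'.+1 * k1) (L' := n.+1 * k2)
           (pow01 _ n r101) (pow01 _ n' r201) _ _ Kn K'n); rewrite ?muln_gt0//.
    rewrite -!exprM !mulnA [(n'.+1 * _)%N]mulnC.
    by rewrite [(_ * k1)%N]mulnC [(_ * k2)%N]mulnC !(exprM _ k1) !(exprM _ k2) rE.
  rewrite -!expnM !mulnA [(n'.+1 * _)%N]mulnC.
  by rewrite [(_ * k1)%N]mulnC [(_ * k2)%N]mulnC !(expnM _ k1) !(expnM _ k2) mE.
have [k1 [k2 [k10 k20 mE]]] := coded_dependent (pow01 _ n r101) (pow01 _ n' r201)
  (pow2 _ n m12) (pow2 _ n' m22) (bilipschitz_coded KK' Kn) K'n.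
rewrite -!expnM in mE.
exists (n.+1 * k1)%N, (n'.+1 * k2)%N; split; rewrite ?muln_gt0//.
(* Equality of dimensions turns the relation between [m1] and [m2] into one between [r1] and [r2]
   with the same exponents. *)
have := dim_eq _ _ _ _ _ _ r101 r201 m12 m22 KA K'A KK'.
rewrite (frakA_dim r101 m12 KA) (frakA_dim r201 m22 K'A) => -[dE].
have := congr1 (fun k => ln (k%:R : R)) mE.
rewrite !natrX !lnXn ?nat0// -[LHS]mulr_natl -[RHS]mulr_natl.
move: (_ * k1)%N (_ * k2)%N => a b lnE.
have [r10 _] := andP r101; have [r20 _] := andP r201.
apply: ln_inj; rewrite ?posrE ?exprn_gt0// !lnXn// -[LHS]mulr_natl -[RHS]mulr_natl.
have := ln0 _ r101; have := ln0 _ r201.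
have lnm : 0 < ln (m1%:R : R) by rewrite ln_gt0// ltr1n.
move=> l2 l1; apply: oppr_inj; rewrite -!mulrN.
apply: (mulfI (lt0r_neq0 lnm)).
move: dE lnE l1 l2; move: (- ln r1) (- ln r2) (ln m1%:R) (ln m2%:R) => x y u v dE lnE x0 y0.
have uv : u * y = v * x.
  by move/eqP: dE; rewrite eqr_div ?lt0r_neq0// => /eqP.
by rewrite mulrCA mulrA lnE -mulrA -uv; ring.
Qed.
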